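(* Let $G$ be a group (not necessarily finite) with two finite subgroups $H$ and $K$ satisfying $H\cap K=\{e\}$. Let $C(\Omega)$ and $C(\widehat\Omega)$ be the two unital $^*$-algebras of complex functions on $\Omega=\{(h,k)\in H\times K: hk\in KH\}$ described in the context. Define a pairing of the algebras $C(\Omega)$ and $C(\widehat\Omega)$ by $\langle f,g\rangle=\sum_{(h,k)\in\Omega}f(h,k)g(h,k)$. Then we have a dual pair of finite $^*$-quantum hypergroups. If $HK=KH$, we have a dual pair of Hopf $^*$-algebras.
   Context: For $(h,k)\in\Omega$ the elements $h\triangleright k\in K$ and $h\triangleleft k\in H$ are defined by $hk=(h\triangleright k)(h\triangleleft k)$ (well defined since $H\cap K=\{e\}$). $C(\Omega)$ is the space of complex functions on $\Omega$ with $(f_1f_2)(h,k)=\sum_v f_1(h,v)f_2(h\triangleleft v,v^{-1}k)$, the sum over $v\in K$ with $(h,v)\in\Omega$, and $f^*(h,k)=\overline{f(h\triangleleft k,k^{-1})}$; the unit is the function equal to $1$ at the points $(h,e)$ and $0$ elsewhere. $C(\widehat\Omega)$ is the same space with $(g_1g_2)(h,k)=\sum_u g_1(hu^{-1},u\triangleright k)g_2(u,k)$, the sum over $u\in H$ with $(u,k)\in\Omega$, and $g^*(h,k)=\overline{g(h^{-1},h\triangleright k)}$; the unit is the function equal to $1$ at the points $(e,k)$ and $0$ elsewhere. For a non-degenerate bilinear pairing of finite-dimensional unital algebras $A,B$ over $\mathbb C$, the induced coproducts are given by $\langle\Delta(a),b\otimes b'\rangle=\langle a,bb'\rangle$ and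 $\langle a\otimes a',\Delta(b)\rangle=\langle aa',b\rangle$; the induced counits are $\varepsilon(a)=\langle a,1\rangle$, $\varepsilon(b)=\langle 1,b\rangle$. A linear functional $\omega$ on $A$ is faithful if $\omega(ac)=0$ for all $c$ implies $a=0$, and $\omega(ac)=0$ for all $a$ implies $c=0$. A linear functional $\varphi$ on $(A,\Delta)$ is a left integral if there is a linear map $S:A\to A$ with $S((\iota\otimes\varphi)(\Delta(a)(1\otimes c)))=(\iota\otimes\varphi)((1\otimes a)\Delta(c))$ for all $a,c\in A$ ($\iota$ the identity map). If $\varphi$ is faithful, $S$ is unique and called the antipode of $\varphi$. A finite quantum hypergroup is a finite-dimensional unital algebra $A$ with a coassociative linear map $\Delta:A\to A\otimes A$ (not assumed multiplicative) admitting a counit, such that there is a faithful left integral, $\Delta(1)=1\otimes1$, the counit is an algebra homomorphism, and the antipode of the integral is an anti-isomorphism of the algebra $A$. It is a finite $^*$-quantum hypergroup if moreover $A$ is a $^*$-algebra and $\Delta(a^* )=\Delta(a)^*$ for all $a$. ''Dual pair of finite $^*$-quantum hypergroups'' (resp. of Hopf $^*$-algebras) means: the pairing is non-degenerate, both algebras with the coproducts induced by the pairing are finite $^*$-quantum hypergroups (resp. Hopf $^*$-algebras), and the involutions are related by $\langle a,b^*\rangle=\overline{\langle S(a)^*,b\rangle}$ with $S$ the antipode of $A$; i.e. each is the dual of the other. *)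

(* Defs.v *)
From HB Require Import structures.
From mathcomp Require Import all_boot all_order all_algebra all_field.
From mathcomp Require Import finmap.
From mathcomp Require Export complex reals.

Set Implicit Arguments.
Unset Strict Implicit.
Unset Printing Implicit Defensive.

Import Order.TTheory GRing.Theory Num.Theory.

Local Open Scope ring_scope.

(** [U (x) V] is the space of coordinate matrices with respect to the bases
    [vbasis {:U}] and [vbasis {:V}]. The maps built with [tens_lift] below do
    not depend on these bases when their argument is bilinear, which is the
    content of [tens_lift_pure]. *)
Definition tensor (F : fieldType) (U V : vectType F) : vectType F :=
  'M[F]_(\dim {:U}, \dim {:V}).

Section Tensor.
Variable F : fieldType.

Definition pure (U V : vectType F) (u : U) (v : V) : tensor U V :=
  \matrix_(i, j) (coord (vbasis {:U}) i u * coord (vbasis {:V}) j v).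

(** The linear extension to [U (x) V] of a bilinear map [b] on [U * V]. *)
Definition tens_lift (U V W : vectType F) (b : U -> V -> W)
    (t : tensor U V) : W :=
  \sum_(i < \dim {:U}) \sum_(j < \dim {:V})
    (t : 'M_(_, _)) i j *: b (vbasis {:U})`_i (vbasis {:V})`_j.

Lemma tens_lift_is_linear (U V W : vectType F) (b : U -> V -> W) :
  linear (tens_lift b).
Proof.
move=> c s t; rewrite /tens_lift scaler_sumr -big_split; apply: eq_bigr => i _.
rewrite scaler_sumr -big_split; apply: eq_bigr => j _ /=.
by rewrite !mxE scalerDl scalerA.
Qed.

Lemma linear_coord (U W : vectType F) (f : U -> W) (u : U) : linear f ->
  f u = \sum_i coord (vbasis {:U}) i u *: f (vbasis {:U})`_i.
Proof.
move=> lf.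
have addf x y : f (x + y) = f x + f y by have := lf 1 x y; rewrite !scale1r.
have f0 : f 0 = 0 by apply: (addrI (f 0)); rewrite -addf !addr0.
have scf c x : f (c *: x) = c *: f x by have := lf c x 0; rewrite f0 !addr0.
rewrite {1}(coord_vbasis (memvf u)).
elim/big_ind2: _ => [|x1 x2 y1 y2 <- <-|i _]; rewrite ?f0 ?addf ?scf //.
Qed.

Lemma tens_lift_pure (U V W : vectType F) (b : U -> V -> W) u v :
    (forall x, linear (b x)) -> (forall y, linear (b^~ y)) ->
  tens_lift b (pure u v) = b u v.
Proof.
move=> br bl; rewrite (linear_coord u (bl v)); apply: eq_bigr => i _.
rewrite (linear_coord v (br _)) scaler_sumr; apply: eq_bigr => j _.
by rewrite mxE scalerA.
Qed.

Definition tens_map (U V U' V' : vectType F) (f : U -> U') (g : V -> V') :=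
  tens_lift (fun u v => pure (f u) (g v)).

Definition tens_assoc (U V W : vectType F) :=
  tens_lift (fun t w =>
    tens_lift (fun (u : U) (v : V) => pure u (pure v (w : W))) t).

Definition slice_l (U V : vectType F) (phi : U -> F) : tensor U V -> V :=
  tens_lift (fun u v => phi u *: v).

Definition slice_r (U V : vectType F) (phi : V -> F) : tensor U V -> U :=
  tens_lift (fun u v => phi v *: u).

Definition tens_pairing (A B : vectType F) (p : A -> B -> F)
    (s : tensor A A) (t : tensor B B) : F :=
  tens_lift (fun a a' =>
    tens_lift (fun b b' => (p a b * p a' b' : F^o)) t) s.

Definition tens_mul (A : falgType F) (s t : tensor A A) : tensor A A :=
  tens_lift (fun a a' => tens_lift (fun b b' => pure (a * b) (a' * b')) t) s.

End Tensor.

Section Coproducts.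
Variables (F : numClosedFieldType) (A : falgType F).
Implicit Types (Delta : A -> tensor A A) (eps phi : A -> F) (S star : A -> A).

Definition coassociative Delta :=
  forall a, tens_assoc (tens_map Delta id (Delta a)) = tens_map id Delta (Delta a).

Definition counital Delta eps :=
  forall a, slice_l eps (Delta a) = a /\ slice_r eps (Delta a) = a.

Definition faithful phi :=
  (forall a, (forall c, phi (a * c) = 0) -> a = 0) /\
  (forall c, (forall a, phi (a * c) = 0) -> c = 0).

(** [phi] is a left integral, with antipode [S]. *)
Definition left_integral Delta phi S :=
  [/\ scalar phi, linear S &
      forall a c, S (slice_r phi (tens_mul (Delta a) (pure 1 c))) =
                  slice_r phi (tens_mul (pure 1 a) (Delta c))].

Definition anti_isomorphism S :=
  [/\ linear S, bijective S, S 1 = 1 & forall a b, S (a * b) = S b * S a].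

(** [(A, Delta)] is a finite quantum hypergroup with counit [eps] and
    antipode [S]. *)
Definition finite_quantum_hypergroup Delta eps S :=
  [/\ linear Delta /\ coassociative Delta,
      scalar eps /\ counital Delta eps,
      monoid_morphism eps,
      Delta 1 = pure 1 1 &
      anti_isomorphism S /\
      exists2 phi : A -> F, faithful phi & left_integral Delta phi S].

Definition hopf_algebra Delta eps S :=
  [/\ linear Delta /\ coassociative Delta,
      scalar eps /\ counital Delta eps,
      monoid_morphism eps,
      Delta 1 = pure 1 1 /\
      (forall a b, Delta (a * b) = tens_mul (Delta a) (Delta b)) &
      linear S /\ forall a,
        tens_lift (fun x y => S x * y) (Delta a) = eps a *: 1 /\
        tens_lift (fun x y => x * S y) (Delta a) = eps a *: 1].

Definition star_algebra star :=
  [/\ forall c a b, star (c *: a + b) = c^* *: star a + star b,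
      involutive star &
      forall a b, star (a * b) = star b * star a].

(** The involution of the tensor square, [(a (x) b)^* = a^* (x) b^*]. It is
    antilinear, so the coordinates are conjugated as well. *)
Definition tens_star star (t : tensor A A) : tensor A A :=
  tens_lift (fun a b => pure (star a) (star b)) (map_mx Num.conj (t : 'M_(_, _))).

Definition star_coproduct Delta star :=
  star_algebra star /\ forall a, Delta (star a) = tens_star star (Delta a).

End Coproducts.

Definition finite_star_quantum_hypergroup (F : numClosedFieldType)
    (A : falgType F) (Delta : A -> tensor A A) eps S star :=
  finite_quantum_hypergroup Delta eps S /\ star_coproduct Delta star.

Definition hopf_star_algebra (F : numClosedFieldType)
    (A : falgType F) (Delta : A -> tensor A A) eps S star :=
  hopf_algebra Delta eps S /\ star_coproduct Delta star.

Section DualPair.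
Variables (F : numClosedFieldType) (A B : falgType F).
Implicit Types (p : A -> B -> F).

Definition bilinear_pairing p :=
  (forall a, scalar (p a)) /\ (forall b, scalar (p^~ b)).

Definition nondegenerate p :=
  (forall a, (forall b, p a b = 0) -> a = 0) /\
  (forall b, (forall a, p a b = 0) -> b = 0).

Definition induced_coproduct_l p (Delta : A -> tensor A A) :=
  forall a b b', tens_pairing p (Delta a) (pure b b') = p a (b * b').

Definition induced_coproduct_r p (Delta : B -> tensor B B) :=
  forall a a' b, tens_pairing p (pure a a') (Delta b) = p (a * a') b.

(** [P A Delta eps S star] says that [A], with the coproduct [Delta], the
    counit [eps], the antipode [S] and the involution [star], has the structure
    under consideration. By non-degeneracy the induced coproducts are unique. *)
Definition dual_pair
    (P : forall X : falgType F,
       (X -> tensor X X) -> (X -> F) -> (X -> X) -> (X -> X) -> Prop)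
    p (starA : A -> A) (starB : B -> B) :=
  [/\ bilinear_pairing p, nondegenerate p &
      exists DeltaA DeltaB SA SB,
        [/\ induced_coproduct_l p DeltaA, induced_coproduct_r p DeltaB,
            P A DeltaA (fun a => p a 1) SA starA,
            P B DeltaB (fun b => p 1 b) SB starB &
            forall a b, p a (starB b) = (p (starA (SA a)) b)^*]].

End DualPair.

Record subgroup_pair (G : groupType) := SubgroupPair {
  lsub : {fset G};
  rsub : {fset G};
  lsub_closed : group_closed [in lsub];
  rsub_closed : group_closed [in rsub];
  lsub_rsub_trivial : (lsub `&` rsub)%fset = [fset 1%g]%fset }.

Section Omega.
Variables (G : groupType) (D : subgroup_pair G).
Local Notation H := (lsub D).
Local Notation K := (rsub D).
Implicit Types h k u v w : G.
Local Open Scope group_scope.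

Definition Omega : {fset G * G} :=
  [fset p in (H `*` K)%fset
     | (p.1 * p.2) \in [fset k * h | k in K, h in H]%fset]%fset.

(** The pair [(v, u)] in [K * H] with [x = v * u] if there is one, and [(1, 1)]
    otherwise; [lact h k] and [ract h k] are thus the elements
    [h |> k] and [h <| k] for [(h, k)] in [Omega]. *)
Definition factorization (x : G) : G * G :=
  oapp val (1, 1) [pick q : (K `*` H)%fset | (val q).1 * (val q).2 == x].

Definition lact h k : G := (factorization (h * k)).1.
Definition ract h k : G := (factorization (h * k)).2.

Lemma lsub1 : 1 \in H. Proof. by case: (lsub_closed D). Qed.
Lemma rsub1 : 1 \in K. Proof. by case: (rsub_closed D). Qed.
Lemma lsubM x y : x \in H -> y \in H -> x * y \in H.
Proof. by move=> hx hy; apply: (group_closedM (lsub_closed D)). Qed.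
Lemma rsubM x y : x \in K -> y \in K -> x * y \in K.
Proof. by move=> hx hy; apply: (group_closedM (rsub_closed D)). Qed.
Lemma lsubV x : x \in H -> x^-1 \in H.
Proof. by move=> hx; apply: (group_closedV (lsub_closed D)). Qed.
Lemma rsubV x : x \in K -> x^-1 \in K.
Proof. by move=> hx; apply: (group_closedV (rsub_closed D)). Qed.

Lemma lrsub1 x : x \in H -> x \in K -> x = 1.
Proof.
move=> xH xK; have: x \in (H `&` K)%fset by rewrite inE xH.
by rewrite lsub_rsub_trivial inE => /eqP.
Qed.

Lemma KH_uniq v v' u u' : v \in K -> v' \in K -> u \in H -> u' \in H ->
  v * u = v' * u' -> v = v' /\ u = u'.
Proof.
move=> vK v'K uH u'H E.
have E' : v'^-1 * v = u' * u^-1.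
  by apply: (mulIg u); rewrite -mulgA E mulKg mulgVK.
have e1 : v'^-1 * v = 1.
  by apply: lrsub1; [rewrite E'; apply: lsubM => //; apply: lsubV | apply: rsubM => //; apply: rsubV].
have ev : v = v' by apply: (mulgI v'^-1); rewrite e1 mulVg.
by split=> //; move: E; rewrite ev => /mulgI.
Qed.

Lemma factorizationE v u : v \in K -> u \in H -> factorization (v * u) = (v, u).
Proof.
move=> vK uH; rewrite /factorization; case: pickP => [[[v' u'] /= q] /eqP /= E|].
  by move: q; rewrite !inE => /andP[/= v'K u'H]; have [-> ->] := KH_uniq v'K vK u'H uH E.
have q : (v, u) \in (K `*` H)%fset by rewrite !inE vK.
by move/(_ [` q]%fset); rewrite /= eqxx.
Qed.

Lemma in_Omega h k :
  reflect [/\ h \in H, k \in K, lact h k \in K, ract h k \in H &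
              h * k = lact h k * ract h k]
          ((h, k) \in Omega).
Proof.
apply: (iffP idP).
  rewrite !inE /= => /andP[/andP[hH kK] /imfset2P[v /= vK [u /= uH E]]].
  by rewrite /lact /ract E factorizationE.
move=> [hH kK vK uH E]; rewrite !inE /= hH kK /=.
by apply/imfset2P; exists (lact h k) => //; exists (ract h k).
Qed.

Lemma OmegaP h k v u : h \in H -> k \in K -> v \in K -> u \in H ->
  h * k = v * u -> [/\ (h, k) \in Omega, lact h k = v & ract h k = u].
Proof.
move=> hH kK vK uH E.
have [e1 e2] : lact h k = v /\ ract h k = u.
  by rewrite /lact /ract E factorizationE.
by split=> //; apply/in_Omega; rewrite e1 e2.
Qed.

Lemma ractP h w u : (h, w) \in Omega -> u \in K ->
  ((ract h w, u) \in Omega) = ((h, w * u) \in Omega) /\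
  ((h, w * u) \in Omega ->
   ract (ract h w) u = ract h (w * u) /\
   lact (ract h w) u = (lact h w)^-1 * lact h (w * u)).
Proof.
case/in_Omega=> hH wK aK bH E uK.
have fwd : (h, w * u) \in Omega ->
    [/\ (ract h w, u) \in Omega,
        lact (ract h w) u = (lact h w)^-1 * lact h (w * u) &
        ract (ract h w) u = ract h (w * u)].
  case/in_Omega=> _ wuK cK dH E'; apply: OmegaP => //.
    by apply: rsubM => //; apply: rsubV.
  by apply: (mulgI (lact h w)); rewrite !mulgA -E mulgV mul1g -mulgA E'.
split; last by move/fwd=> [_ -> ->].
apply/idP/idP; last by case/fwd.
case/in_Omega=> _ _ cK dH E'.
have [] // := @OmegaP h (w * u) (lact h w * lact (ract h w) u) (ract (ract h w) u) hH.
- exact: rsubM.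
- exact: rsubM.
- by rewrite mulgA E -!mulgA E'.
Qed.

Lemma lactP w u k : (u, k) \in Omega -> w \in H ->
  ((w, lact u k) \in Omega) = ((w * u, k) \in Omega) /\
  ((w * u, k) \in Omega ->
   lact w (lact u k) = lact (w * u) k /\
   ract w (lact u k) = ract (w * u) k * (ract u k)^-1).
Proof.
case/in_Omega=> uH kK aK bH E wH.
have fwd : (w * u, k) \in Omega ->
    [/\ (w, lact u k) \in Omega, lact w (lact u k) = lact (w * u) k &
        ract w (lact u k) = ract (w * u) k * (ract u k)^-1].
  case/in_Omega=> wuH _ cK dH E'; apply: OmegaP => //.
    by apply: lsubM => //; apply: lsubV.
  by apply: (mulIg (ract u k)); rewrite !mulgA mulgVK -E' -!mulgA E.
split; last by move/fwd=> [_ -> ->].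
apply/idP/idP; last by case/fwd.
case/in_Omega=> _ _ cK dH E'.
have [] // := @OmegaP (w * u) k (lact w (lact u k)) (ract w (lact u k) * ract u k) _ kK.
- exact: lsubM.
- exact: lsubM.
- by rewrite mulgA -E' -!mulgA E.
Qed.

Lemma Omegah1 h : h \in H -> [/\ (h, 1) \in Omega, lact h 1 = 1 & ract h 1 = h].
Proof. by move=> hH; apply: OmegaP; rewrite ?rsub1 ?mulg1 ?mul1g. Qed.

Lemma Omega1k k : k \in K -> [/\ (1, k) \in Omega, lact 1 k = k & ract 1 k = 1].
Proof. by move=> kK; apply: OmegaP; rewrite ?lsub1 ?mulg1 ?mul1g. Qed.

End Omega.

Section Functions.
Variables (F : numClosedFieldType) (G : groupType) (D : subgroup_pair G).
Local Notation H := (lsub D).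
Local Notation K := (rsub D).
Local Notation Om := (Omega D).

(** Evaluation at [(h, k)], with value [0] when [(h, k)] is not in [Omega]. *)
Definition ev (f : {ffun Om -> F^o}) (h k : G) : F := oapp f 0 (insub (h, k)).

Definition of_fun (a : G -> G -> F) : {ffun Om -> F^o} :=
  [ffun x => a (val x).1 (val x).2].

Lemma ev_of_fun a h k : (h, k) \in Om -> ev (of_fun a) h k = a h k.
Proof. by move=> hk; rewrite /ev insubT /= ffunE. Qed.

Lemma ev_val f (x : Om) : ev f (val x).1 (val x).2 = f x.
Proof. by rewrite /ev -surjective_pairing valK. Qed.

Lemma evP f g : (forall h k, (h, k) \in Om -> ev f h k = ev g h k) -> f = g.
Proof.
move=> fg; apply/ffunP=> x; rewrite -!ev_val; apply: fg.
by rewrite -surjective_pairing (valP x).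
Qed.

Lemma evD f g h k : ev (f + g) h k = ev f h k + ev g h k.
Proof. by rewrite /ev; case: insub => [x|] /=; rewrite ?ffunE ?addr0. Qed.

Lemma evZ c f h k : ev (c *: f) h k = c * ev f h k.
Proof. by rewrite /ev; case: insub => [x|] /=; rewrite ?ffunE ?mulr0. Qed.

Definition C_mul (f1 f2 : {ffun Om -> F^o}) := of_fun (fun h k =>
  \sum_(v <- K | (h, v) \in Om) ev f1 h v * ev f2 (ract D h v) (v^-1 * k)%g).

Definition C_one := of_fun (fun _ k => (k == 1%g)%:R).

Definition C_star (f : {ffun Om -> F^o}) :=
  of_fun (fun h k => (ev f (ract D h k) k^-1%g)^*).

Definition Chat_mul (g1 g2 : {ffun Om -> F^o}) := of_fun (fun h k =>
  \sum_(u <- H | (u, k) \in Om) ev g1 (h * u^-1)%g (lact D u k) * ev g2 u k).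

Definition Chat_one := of_fun (fun h _ => (h == 1%g)%:R).

Definition Chat_star (g : {ffun Om -> F^o}) :=
  of_fun (fun h k => (ev g h^-1%g (lact D h k))^*).

Lemma sum_mulKl (w : G) (a : G -> F) (P : pred G) : w \in K ->
  \sum_(v <- K | P v) a v = \sum_(v <- K | P (w * v)%g) a (w * v)%g.
Proof.
move=> wK; rewrite -(big_map (fun x => w * x)%g P a); apply: perm_big.
apply: uniq_perm; rewrite ?fset_uniq ?(map_inj_uniq (@mulgI _ w)) ?fset_uniq //.
move=> x; apply/idP/mapP => [xK|[y yK ->]]; last exact: rsubM.
by exists (w^-1 * x)%g; rewrite ?mulVKg //; apply: rsubM => //; apply: rsubV.
Qed.

Lemma sum_mulHr (w : G) (a : G -> F) (P : pred G) : w \in H ->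
  \sum_(v <- H | P v) a v = \sum_(v <- H | P (v * w)%g) a (v * w)%g.
Proof.
move=> wH; rewrite -(big_map (fun x => x * w)%g P a); apply: perm_big.
apply: uniq_perm; rewrite ?fset_uniq ?(map_inj_uniq (@mulIg _ w)) ?fset_uniq //.
move=> x; apply/idP/mapP => [xH|[y yH ->]]; last exact: lsubM.
by exists (x * w^-1)%g; rewrite ?mulgVK //; apply: lsubM => //; apply: lsubV.
Qed.

Lemma C_mulA : associative C_mul.
Proof.
move=> f1 f2 f3; apply: evP => h k hk; rewrite !ev_of_fun //.
case/in_Omega: (hk) => hH kK _ _ _.
transitivity (\sum_(w <- K | (h, w) \in Om) \sum_(v <- K | (h, v) \in Om)
   ev f1 h w * (ev f2 (ract D h w) (w^-1 * v)%g *
                ev f3 (ract D h v) (v^-1 * k)%g)).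
  rewrite big_seq_cond [RHS]big_seq_cond; apply: eq_bigr => w /andP[wK hw].
  have uK : (w^-1 * k)%g \in K by apply: rsubM => //; apply: rsubV.
  rewrite ev_of_fun; last by rewrite (ractP hw uK).1 mulVKg.
  rewrite mulr_sumr [RHS](sum_mulKl _ _ wK) big_seq_cond [RHS]big_seq_cond.
  apply: eq_big => [v|v /andP[vK hv]].
    by case: (boolP (v \in K)) => //= vK; rewrite (ractP hw vK).1.
  have [e1 e2] := ractP hw vK; rewrite e1 in hv; have [-> _] := e2 hv.
  by rewrite mulKg invgM mulgA.
rewrite exchange_big big_seq_cond [RHS]big_seq_cond /=.
apply: eq_bigr => v /andP[vK hv]; rewrite ev_of_fun // mulr_suml.
by apply: eq_bigr => w _; rewrite mulrA.
Qed.

Lemma sum_single (A : {fset G}) (v0 : G) (P : pred G) (a : G -> F) :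
    v0 \in A -> P v0 -> (forall v, v \in A -> P v -> v != v0 -> a v = 0) ->
  \sum_(v <- A | P v) a v = a v0.
Proof.
move=> v0A Pv0 a0; rewrite big_seq_cond big_mkcond (bigD1_seq v0) ?fset_uniq //=.
rewrite v0A Pv0 /= big1 ?addr0 // => v vv0.
by case: ifP => // /andP[vA Pv]; apply: a0.
Qed.

Lemma C_mul1r : left_id C_one C_mul.
Proof.
move=> f; apply: evP => h k hk; rewrite !ev_of_fun //.
case/in_Omega: (hk) => hH kK _ _ _; have [h1 _ rh1] := Omegah1 hH.
rewrite (sum_single (v0 := 1%g)) ?rsub1 // => [|v vK hv /negPf v1].
  by rewrite ev_of_fun // eqxx rh1 invg1 !mul1g mul1r.
by rewrite ev_of_fun // v1 mul0r.
Qed.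

Lemma C_mulr1 : right_id C_one C_mul.
Proof.
move=> f; apply: evP => h k hk; rewrite !ev_of_fun //.
case/in_Omega: (hk) => hH kK _ rH _; have [h1 _ _] := Omegah1 rH.
rewrite (sum_single (v0 := k)) // => [|v vK hv vk].
  by rewrite mulVg ev_of_fun // eqxx mulr1.
have vkK : (v^-1 * k)%g \in K by apply: rsubM => //; apply: rsubV.
rewrite ev_of_fun; last by rewrite (ractP hv vkK).1 mulVKg.
rewrite (_ : (_ == _) = false) ?mulr0 //; apply: contraNF vk => /eqP E.
by apply/eqP; apply: (mulgI v^-1%g); rewrite E mulVg.
Qed.

Lemma Chat_mulA : associative Chat_mul.
Proof.
move=> f1 f2 f3; apply: evP => h k hk; rewrite !ev_of_fun //.
case/in_Omega: (hk) => hH kK _ _ _.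
transitivity (\sum_(u <- H | (u, k) \in Om) \sum_(v <- H | (v, k) \in Om)
   ev f1 (h * v^-1)%g (lact D v k) *
     (ev f2 (v * u^-1)%g (lact D u k) * ev f3 u k)).
  rewrite exchange_big big_seq_cond [RHS]big_seq_cond /=.
  apply: eq_bigr => v /andP[vH vk]; rewrite ev_of_fun // mulr_sumr.
  by apply: eq_bigr => w _; rewrite mulrA.
rewrite big_seq_cond [RHS]big_seq_cond; apply: eq_bigr => u /andP[uH uk].
have wH : (h * u^-1)%g \in H by apply: lsubM => //; apply: lsubV.
rewrite ev_of_fun; last by rewrite (lactP uk wH).1 mulgVK.
rewrite mulr_suml (sum_mulHr _ _ uH) big_seq_cond [RHS]big_seq_cond.
apply: eq_big => [v|v /andP[vH vk]].
  by case: (boolP (v \in H)) => //= vH; rewrite (lactP uk vH).1.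
have [e1 e2] := lactP uk vH; have [-> _] := e2 vk.
by rewrite mulgK invgM !mulgA mulrA.
Qed.

Lemma Chat_mul1r : left_id Chat_one Chat_mul.
Proof.
move=> f; apply: evP => h k hk; rewrite !ev_of_fun //.
case/in_Omega: (hk) => hH kK lK _ _; have [k1 _ _] := Omega1k lK.
rewrite (sum_single (v0 := h)) // => [|u uH uk uh].
  by rewrite mulgV ev_of_fun // eqxx mul1r.
have huH : (h * u^-1)%g \in H by apply: lsubM => //; apply: lsubV.
rewrite ev_of_fun; last by rewrite (lactP uk huH).1 mulgVK.
rewrite (_ : (_ == _) = false) ?mul0r //; apply: contraNF uh => /eqP E.
by apply/eqP; apply: (mulIg u^-1%g); rewrite E mulgV.
Qed.

Lemma Chat_mulr1 : right_id Chat_one Chat_mul.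
Proof.
move=> f; apply: evP => h k hk; rewrite !ev_of_fun //.
case/in_Omega: (hk) => hH kK _ _ _; have [k1 lk1 _] := Omega1k kK.
rewrite (sum_single (v0 := 1%g)) ?lsub1 // => [|u uH uk /negPf u1].
  by rewrite ev_of_fun // eqxx lk1 invg1 mulg1 mulr1.
by rewrite [ev Chat_one _ _]ev_of_fun // u1 mulr0.
Qed.

Lemma C_mulDl : left_distributive C_mul +%R.
Proof.
move=> f f' g; apply: evP => h k hk; rewrite evD !ev_of_fun // -big_split /=.
by apply: eq_bigr => v _; rewrite evD mulrDl.
Qed.

Lemma C_mulDr : right_distributive C_mul +%R.
Proof.
move=> f g g'; apply: evP => h k hk; rewrite evD !ev_of_fun // -big_split /=.
by apply: eq_bigr => v _; rewrite evD mulrDr.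
Qed.

Lemma C_mulZl c f g : c *: C_mul f g = C_mul (c *: f) g.
Proof.
apply: evP => h k hk; rewrite evZ !ev_of_fun // mulr_sumr.
by apply: eq_bigr => v _; rewrite evZ mulrA.
Qed.

Lemma C_mulZr c f g : c *: C_mul f g = C_mul f (c *: g).
Proof.
apply: evP => h k hk; rewrite evZ !ev_of_fun // mulr_sumr.
by apply: eq_bigr => v _; rewrite evZ mulrCA.
Qed.

Lemma Chat_mulDl : left_distributive Chat_mul +%R.
Proof.
move=> f f' g; apply: evP => h k hk; rewrite evD !ev_of_fun // -big_split /=.
by apply: eq_bigr => v _; rewrite evD mulrDl.
Qed.

Lemma Chat_mulDr : right_distributive Chat_mul +%R.
Proof.
move=> f g g'; apply: evP => h k hk; rewrite evD !ev_of_fun // -big_split /=.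
by apply: eq_bigr => v _; rewrite evD mulrDr.
Qed.

Lemma Chat_mulZl c f g : c *: Chat_mul f g = Chat_mul (c *: f) g.
Proof.
apply: evP => h k hk; rewrite evZ !ev_of_fun // mulr_sumr.
by apply: eq_bigr => v _; rewrite evZ mulrA.
Qed.

Lemma Chat_mulZr c f g : c *: Chat_mul f g = Chat_mul f (c *: g).
Proof.
apply: evP => h k hk; rewrite evZ !ev_of_fun // mulr_sumr.
by apply: eq_bigr => v _; rewrite evZ mulrCA.
Qed.

Lemma C_one_neq0 : C_one != 0.
Proof.
have [k1 _ _] := Omegah1 (lsub1 D); apply/eqP => /(congr1 (fun f => ev f 1%g 1%g)).
rewrite ev_of_fun // eqxx -[0](scale0r (0 : {ffun Om -> F^o})) evZ mul0r.
by apply/eqP/oner_neq0.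
Qed.

Lemma Chat_one_neq0 : Chat_one != 0.
Proof.
have [k1 _ _] := Omegah1 (lsub1 D); apply/eqP => /(congr1 (fun f => ev f 1%g 1%g)).
rewrite ev_of_fun // eqxx -[0](scale0r (0 : {ffun Om -> F^o})) evZ mul0r.
by apply/eqP/oner_neq0.
Qed.

End Functions.

Definition C_Omega (F : numClosedFieldType) (G : groupType)
  (D : subgroup_pair G) : Type := {ffun Omega D -> F^o}.

Definition C_Omega_hat (F : numClosedFieldType) (G : groupType)
  (D : subgroup_pair G) : Type := {ffun Omega D -> F^o}.

Section Algebras.
Variables (F : numClosedFieldType) (G : groupType) (D : subgroup_pair G).

HB.instance Definition _ := Vector.copy (C_Omega F D) {ffun Omega D -> F^o}.
HB.instance Definition _ := GRing.Zmodule_isNzRing.Build (C_Omega F D)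
  (@C_mulA F G D) (@C_mul1r F G D) (@C_mulr1 F G D)
  (@C_mulDl F G D) (@C_mulDr F G D) (@C_one_neq0 F G D).
HB.instance Definition _ := GRing.Lmodule_isLalgebra.Build F (C_Omega F D)
  (@C_mulZl F G D).
HB.instance Definition _ := GRing.Lalgebra_isAlgebra.Build F (C_Omega F D)
  (@C_mulZr F G D).
HB.instance Definition _ := Algebra_isFalgebra.Build F (C_Omega F D).

HB.instance Definition _ := Vector.copy (C_Omega_hat F D) {ffun Omega D -> F^o}.
HB.instance Definition _ := GRing.Zmodule_isNzRing.Build (C_Omega_hat F D)
  (@Chat_mulA F G D) (@Chat_mul1r F G D) (@Chat_mulr1 F G D)
  (@Chat_mulDl F G D) (@Chat_mulDr F G D) (@Chat_one_neq0 F G D).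
HB.instance Definition _ := GRing.Lmodule_isLalgebra.Build F (C_Omega_hat F D)
  (@Chat_mulZl F G D).
HB.instance Definition _ := GRing.Lalgebra_isAlgebra.Build F (C_Omega_hat F D)
  (@Chat_mulZr F G D).
HB.instance Definition _ := Algebra_isFalgebra.Build F (C_Omega_hat F D).

Lemma C_OmegaE (f g : C_Omega F D) h k : (h, k) \in Omega D ->
  ev (f * g) h k =
  \sum_(v <- rsub D | (h, v) \in Omega D)
     ev f h v * ev g (ract D h v) (v^-1 * k)%g.
Proof. exact: ev_of_fun. Qed.

Lemma C_Omega1E h k : (h, k) \in Omega D ->
  ev (1 : C_Omega F D) h k = (k == 1%g)%:R.
Proof. exact: ev_of_fun. Qed.

Lemma C_Omega_hatE (f g : C_Omega_hat F D) h k : (h, k) \in Omega D ->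
  ev (f * g) h k =
  \sum_(u <- lsub D | (u, k) \in Omega D)
     ev f (h * u^-1)%g (lact D u k) * ev g u k.
Proof. exact: ev_of_fun. Qed.

Lemma C_Omega_hat1E h k : (h, k) \in Omega D ->
  ev (1 : C_Omega_hat F D) h k = (h == 1%g)%:R.
Proof. exact: ev_of_fun. Qed.

Lemma C_OmegaZE c (f : C_Omega F D) x : (c *: f) x = c * f x.
Proof. exact: ffunE. Qed.

Lemma C_Omega_hatZE c (f : C_Omega_hat F D) x : (c *: f) x = c * f x.
Proof. exact: ffunE. Qed.

Definition Omega_pairing (f : C_Omega F D) (g : C_Omega_hat F D) : F :=
  \sum_(x : Omega D) f x * g x.

Definition Omega_star : C_Omega F D -> C_Omega F D := @C_star F G D.

Definition Omega_hat_star : C_Omega_hat F D -> C_Omega_hat F D :=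
  @Chat_star F G D.

End Algebras.

(* Main.v *)
(** An element of Omega is a square with edges h, k, v, u such that h k = v u,
    where v = h |> k and u = h <| k. Two squares with u = h' compose to
    (h, k k', v v', u'), two squares with k = v' compose to
    (h h', k', v, u u'). The product of C(Omega) is the convolution for the
    first composition and its coproduct is dual to the second one; for the other
    algebra the two compositions are exchanged. Exchanging (h, k) and (v, u)
    swaps the compositions, so that everything is proved for one algebra over an
    abstract set of squares and then applied twice. A square is determined by
    any of its corners (h, k), (v, u), (h, v), (k, u), because H and K meet
    trivially. When H K = K H every corner occurs, and then a square which is
    composed in both ways can be cut into four squares: this makes the coproduct
    multiplicative. *)
Require Import Defs.
From mathcomp Require Import all_boot all_order all_algebra all_field.
From mathcomp Require Import finmap complex reals.

Set Implicit Arguments.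
Unset Strict Implicit.
Unset Printing Implicit Defensive.

Import Order.TTheory GRing.Theory Num.Theory.
Local Open Scope ring_scope.

(** * Coordinates and tensors *)

Section Linear.
Variable F : fieldType.

Lemma linear_lincomb (U W : vectType F) (f : U -> W) : linear f ->
  forall (I : Type) (r : seq I) (P : pred I) (a : I -> F) (w : I -> U),
  f (\sum_(i <- r | P i) a i *: w i) = \sum_(i <- r | P i) a i *: f (w i).
Proof.
move=> lf I r P a w.
have f0 : f 0 = 0.
  by have := lf 1 0 0; rewrite !scale1r !addr0 -{1}[f 0]addr0 => /addrI /esym.
elim: r => [|i r IH]; first by rewrite !big_nil.
by rewrite !big_cons; case: ifP => // _; rewrite lf IH.
Qed.

Definition bilinear_map (U V W : vectType F) (b : U -> V -> W) :=
  (forall x, linear (b x)) /\ (forall y, linear (b^~ y)).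

Lemma bilinear_lincomb (U V W : vectType F) (b : U -> V -> W) : bilinear_map b ->
  forall (I J : finType) (a : I -> F) (c : J -> F) (u : I -> U) (v : J -> V),
  b (\sum_i a i *: u i) (\sum_j c j *: v j) =
  \sum_i \sum_j (a i * c j) *: b (u i) (v j).
Proof.
move=> [br bl] I J a c u v; rewrite (linear_lincomb (bl _)); apply: eq_bigr => i _.
rewrite (linear_lincomb (br _)) scaler_sumr; apply: eq_bigr => j _.
by rewrite scalerA.
Qed.

Lemma bilinear_pure (U V : vectType F) : bilinear_map (@pure F U V).
Proof.
split=> x c u v; apply/matrixP=> i j; rewrite !mxE linearP /=.
  by rewrite mulrDr mulrCA.
by rewrite mulrDl mulrA.
Qed.

Lemma coord_vbasis_nth (U : vectType F) (i j : 'I_(\dim {:U})) :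
  coord (vbasis {:U}) i (vbasis {:U})`_j = (i == j)%:R.
Proof. by rewrite coord_free ?(basis_free (vbasisP _)) 1?eq_sym. Qed.

Lemma tens_lift_id (U V : vectType F) (t : tensor U V) :
  tens_lift (@pure F U V) t = t.
Proof.
rewrite [RHS]matrix_sum_delta; apply: eq_bigr => i _; apply: eq_bigr => j _.
congr (_ *: _); apply/matrixP=> k l; rewrite !mxE !coord_vbasis_nth.
by rewrite -natrM mulnb.
Qed.

End Linear.

(** A basis of [U] indexed by a finite type, with its coordinate functionals. [tensor] rests on the
    arbitrary basis [vbasis]; this record allows all computations to be made in the basis of point
    masses. *)
Record coords (F : fieldType) (U : vectType F) (X : finType) := Coords {
  co : U -> X -> F;
  ba : X -> U;
  co_scalar : forall x, scalar (co^~ x);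
  co_expand : forall u, u = \sum_x co u x *: ba x;
  co_ba : forall x y, co (ba x) y = (x == y)%:R }.

Section Coords.
Variables (F : fieldType) (U : vectType F) (X : finType) (C : coords U X).

Lemma coP u v : co C u =1 co C v -> u = v.
Proof.
move=> uv; rewrite (co_expand C u) (co_expand C v).
by apply: eq_bigr => x _; rewrite uv.
Qed.

Lemma coPl c u v x : co C (c *: u + v) x = c * co C u x + co C v x.
Proof. exact: co_scalar. Qed.

Lemma co0 x : co C 0 x = 0.
Proof.
by have := coPl 1 0 0 x; rewrite scale1r addr0 mul1r -{1}[co C 0 x]addr0 => /addrI.
Qed.

Lemma coZ c u x : co C (c *: u) x = c * co C u x.
Proof. by rewrite -[c *: u]addr0 coPl co0 addr0. Qed.

Lemma co_sum (I : finType) (a : I -> F) (w : I -> U) x :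
  co C (\sum_i a i *: w i) x = \sum_i a i * co C (w i) x.
Proof. exact: (@linear_lincomb F U F^o (fun u => co C u x) (co_scalar C x)). Qed.

Definition of_co (f : X -> F) : U := \sum_x f x *: ba C x.

Lemma of_coK f : co C (of_co f) =1 f.
Proof.
move=> x; rewrite co_sum (bigD1 x) //= co_ba eqxx mulr1 big1 ?addr0 // => y.
by rewrite co_ba => /negPf ->; rewrite mulr0.
Qed.

Lemma sum_co_ba (f : X -> F) x : \sum_y f y * co C (ba C y) x = f x.
Proof. by rewrite -co_sum of_coK. Qed.

Lemma sum_co_bar (f : X -> F) x : \sum_y co C (ba C x) y * f y = f x.
Proof.
rewrite -[RHS]sum_co_ba; apply: eq_bigr => y _.
by rewrite mulrC !co_ba eq_sym.
Qed.

End Coords.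

Section TensorCoords.
Variables (F : fieldType) (U V : vectType F) (X Y : finType).
Variables (CU : coords U X) (CV : coords V Y).

(** Extended from a bilinear form by [tens_lift], so that the value on pure tensors does not depend
    on [vbasis]. *)
Definition tco (t : tensor U V) (p : X * Y) : F :=
  tens_lift (fun u v => co CU u p.1 * co CV v p.2 : F^o) t.

Lemma bilinear_co p :
  bilinear_map (fun u v => co CU u p.1 * co CV v p.2 : F^o).
Proof.
split=> [u|v] c x y /=; rewrite coPl.
  by rewrite mulrDr mulrCA.
by rewrite mulrDl -mulrA.
Qed.

Lemma tco_pure u v p : tco (pure u v) p = co CU u p.1 * co CV v p.2.
Proof. by have [br bl] := bilinear_co p; rewrite /tco tens_lift_pure. Qed.

(** Change of basis: the vectors of [vbasis] are expanded in the given bases, and the collected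
    coefficient of a pair of basis vectors is [tco]. *)
Lemma tens_lift_tco (W : vectType F) (b : U -> V -> W) t : bilinear_map b ->
  tens_lift b t = \sum_p tco t p *: b (ba CU p.1) (ba CV p.2).
Proof.
move=> bb; rewrite /tens_lift /tco.
under eq_bigr do under eq_bigr do
  rewrite [X in b X _](co_expand CU) [X in b _ X](co_expand CV) bilinear_lincomb //.
under eq_bigr do under eq_bigr do rewrite pair_big /= scaler_sumr.
under eq_bigr do rewrite exchange_big /=.
rewrite exchange_big /=; apply: eq_bigr => -[x y] _.
rewrite /tens_lift scaler_suml; apply: eq_bigr => i _.
by rewrite scaler_suml; apply: eq_bigr => j _; rewrite scalerA.
Qed.

Lemma tco_scalar p : scalar (tco^~ p).
Proof.
exact: (@tens_lift_is_linear F U V F^o (fun u v => co CU u p.1 * co CV v p.2)).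
Qed.

(** Kept transparent because [co_tens_star] unfolds these coordinates back to a sum over
    [vbasis]. *)
Definition tensor_coords : coords (tensor U V) (X * Y)%type.
Proof.
refine (@Coords _ _ _ tco (fun p => pure (ba CU p.1) (ba CV p.2)) tco_scalar _ _).
  move=> t; rewrite -[LHS]tens_lift_id; apply: tens_lift_tco.
  exact: bilinear_pure.
by move=> [x y] [x' y']; rewrite tco_pure !co_ba -natrM mulnb.
Defined.

Lemma co_pure u v p :
  co tensor_coords (pure u v) p = co CU u p.1 * co CV v p.2.
Proof. exact: tco_pure. Qed.

Lemma tens_lift_co (W : vectType F) (b : U -> V -> W) t : bilinear_map b ->
  tens_lift b t = \sum_p co tensor_coords t p *: b (ba CU p.1) (ba CV p.2).
Proof. exact: tens_lift_tco. Qed.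

End TensorCoords.
Arguments co : simpl never.

(** * Coordinates of the structural maps of tensor products *)

Section TensorMaps.
Variable F : fieldType.

Lemma linear_tens_lift (U V W Z : vectType F) (b : Z -> U -> V -> W) t :
  (forall u v, linear (fun z => b z u v)) -> linear (fun z => tens_lift (b z) t).
Proof.
move=> lb c z z'; rewrite /tens_lift scaler_sumr -big_split.
apply: eq_bigr => i _; rewrite scaler_sumr -big_split; apply: eq_bigr => j _ /=.
by rewrite lb scalerDr !scalerA mulrC.
Qed.

Lemma eq_tens_lift (U V W : vectType F) (b b' : U -> V -> W) t :
  (forall u v, b u v = b' u v) -> tens_lift b t = tens_lift b' t.
Proof.
by move=> bb; apply: eq_bigr => i _; apply: eq_bigr => j _; rewrite bb.
Qed.

Lemma bilinear_comp (U V U' V' W : vectType F) (b : U' -> V' -> W)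
    (f : U -> U') (g : V -> V') :
  bilinear_map b -> linear f -> linear g ->
  bilinear_map (fun u v => b (f u) (g v)).
Proof. by move=> [br bl] lf lg; split=> [u|v] c x y; rewrite ?lf ?lg ?br ?bl. Qed.

Lemma linear_id (U : vectType F) : linear (@id U).
Proof. by []. Qed.

Lemma co_tens_assoc (U V W : vectType F) (X Y Z : finType)
    (CU : coords U X) (CV : coords V Y) (CW : coords W Z) t x y z :
  co (tensor_coords CU (tensor_coords CV CW)) (tens_assoc t) (x, (y, z)) =
  co (tensor_coords (tensor_coords CU CV) CW) t ((x, y), z).
Proof.
rewrite /tens_assoc (tens_lift_co (tensor_coords CU CV) CW); last first.
  split=> [s|w]; last exact: tens_lift_is_linear.
  apply: linear_tens_lift => u v c w w'.
  by rewrite (bilinear_pure V W).1 (bilinear_pure _ _).1.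
rewrite co_sum -[RHS](sum_co_ba (tensor_coords (tensor_coords CU CV) CW) (co _ t)).
apply: eq_bigr => p _; congr (_ * _).
have [br bl] := bilinear_comp (bilinear_pure U (tensor V W)) (@linear_id _)
  ((bilinear_pure V W).2 (ba CW p.2)).
by rewrite tens_lift_pure // co_ba !co_pure !co_ba /= -!natrM !mulnb andbA.
Qed.

Lemma co_tens_map (U V U' V' : vectType F) (X Y X' Y' : finType)
    (CU : coords U X) (CV : coords V Y) (CU' : coords U' X') (CV' : coords V' Y')
    (f : U -> U') (g : V -> V') t p : linear f -> linear g ->
  co (tensor_coords CU' CV') (tens_map f g t) p =
  \sum_x \sum_y co (tensor_coords CU CV) t (x, y) *
    (co CU' (f (ba CU x)) p.1 * co CV' (g (ba CV y)) p.2).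
Proof.
move=> lf lg; rewrite /tens_map (tens_lift_co CU CV).
  rewrite co_sum pair_bigA; apply: eq_bigr => -[x y] _ /=.
  by rewrite co_pure.
exact: bilinear_comp (bilinear_pure _ _) lf lg.
Qed.

Lemma co_slice_l (U V : vectType F) (X Y : finType) (CU : coords U X)
    (CV : coords V Y) (phi : U -> F) t y : scalar phi ->
  co CV (slice_l phi t) y =
  \sum_x co (tensor_coords CU CV) t (x, y) * phi (ba CU x).
Proof.
move=> lphi; rewrite /slice_l (tens_lift_co CU CV); last first.
  split=> [u|v] c x x'; first by rewrite scalerDr !scalerA mulrC.
  by rewrite lphi scalerDl scalerA.
rewrite co_sum -(pair_bigA _ (fun x y' => co (tensor_coords CU CV) t (x, y') *
   co CV (phi (ba CU x) *: ba CV y') y)).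
apply: eq_bigr => x _; rewrite -[RHS](sum_co_ba CV (fun y => _ t (x, y) * _)).
by apply: eq_bigr => y' _; rewrite coZ mulrA.
Qed.

Lemma co_slice_r (U V : vectType F) (X Y : finType) (CU : coords U X)
    (CV : coords V Y) (phi : V -> F) t x : scalar phi ->
  co CU (slice_r phi t) x =
  \sum_y co (tensor_coords CU CV) t (x, y) * phi (ba CV y).
Proof.
move=> lphi; rewrite /slice_r (tens_lift_co CU CV); last first.
  split=> [u|v] c y y'; last by rewrite scalerDr !scalerA mulrC.
  by rewrite lphi scalerDl scalerA.
rewrite co_sum -(pair_bigA _ (fun x' y => co (tensor_coords CU CV) t (x', y) *
   co CU (phi (ba CV y) *: ba CU x') x)) exchange_big.
apply: eq_bigr => y _; rewrite -[RHS](sum_co_ba CU (fun x => _ t (x, y) * _)).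
by apply: eq_bigr => x' _; rewrite coZ mulrA.
Qed.

End TensorMaps.

(** * Coordinates in the tensor square of an algebra *)

Section TensorAlgebra.
Variables (F : fieldType) (A : falgType F) (X : finType) (C : coords A X).
Local Notation C2 := (tensor_coords C C).

Lemma bilinear_mul : bilinear_map (@GRing.mul A).
Proof.
split=> a c x y; first by rewrite mulrDr scalerAr.
by rewrite mulrDl scalerAl.
Qed.

Lemma bilinear_tens_mul_pure (a a' : A) :
  bilinear_map (fun b b' => pure (a * b) (a' * b')).
Proof.
exact: bilinear_comp (bilinear_pure _ _) (bilinear_mul.1 a) (bilinear_mul.1 a').
Qed.

Lemma bilinear_tens_mul t :
  bilinear_map (fun a a' : A => tens_lift (fun b b' => pure (a * b) (a' * b')) t).
Proof.
have [br bl] := bilinear_pure A A; have [mr ml] := bilinear_mul.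
by split=> a; apply: linear_tens_lift => u v c x y; rewrite ml ?br ?bl.
Qed.

Lemma tens_mul_purel (a a' : A) t :
  tens_mul (pure a a') t = tens_lift (fun b b' => pure (a * b) (a' * b')) t.
Proof. by have [br bl] := bilinear_tens_mul t; rewrite /tens_mul tens_lift_pure. Qed.

Lemma tens_mul_purer t (b b' : A) :
  tens_mul t (pure b b') = tens_lift (fun a a' => pure (a * b) (a' * b')) t.
Proof.
apply: eq_tens_lift => a a'; have [br bl] := bilinear_tens_mul_pure a a'.
by rewrite tens_lift_pure.
Qed.

Lemma co_tens_mul s t p : co C2 (tens_mul s t) p =
  \sum_m \sum_n (co C2 s m * co C2 t n) *
    (co C (ba C m.1 * ba C n.1) p.1 * co C (ba C m.2 * ba C n.2) p.2).
Proof.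
rewrite /tens_mul (tens_lift_co C C _ (bilinear_tens_mul t)) co_sum.
apply: eq_bigr => m _; rewrite (tens_lift_co C C _ (bilinear_tens_mul_pure _ _)).
rewrite co_sum mulr_sumr; apply: eq_bigr => n _; rewrite mulrA; congr (_ * _).
by rewrite co_pure.
Qed.

Lemma slice_r_pure (phi : A -> F) (a b : A) : scalar phi ->
  slice_r phi (pure a b) = phi b *: a.
Proof.
move=> lphi; rewrite /slice_r tens_lift_pure // => x c y y'.
  by rewrite lphi scalerDl scalerA.
by rewrite scalerDr !scalerA mulrC.
Qed.

Lemma linear_slice_r (phi : A -> F) : linear (@slice_r F A A phi).
Proof. exact: tens_lift_is_linear. Qed.

(** With [co_slice_mull], this puts the two sides of the equation of a left integral into
    coordinates. Only the second leg is multiplied and integrated, so the first index stays free. *)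
Lemma co_slice_mulr (phi : A -> F) t c x : scalar phi ->
  co C (slice_r phi (tens_mul t (pure 1 c))) x =
  \sum_y co C2 t (x, y) * phi (ba C y * c).
Proof.
move=> lphi; rewrite tens_mul_purer (tens_lift_co C C); last first.
  exact: bilinear_comp (bilinear_pure _ _) (bilinear_mul.2 1) (bilinear_mul.2 c).
rewrite (linear_lincomb (linear_slice_r _)) co_sum.
under eq_bigr do rewrite slice_r_pure // mulr1 coZ.
rewrite -(pair_bigA _ (fun x' y => co C2 t (x', y) *
   (phi (ba C y * c) * co C (ba C x') x))) exchange_big.
apply: eq_bigr => y _; rewrite -[RHS](sum_co_ba C (fun x => _ t (x, y) * _)).
by apply: eq_bigr => x' _; rewrite mulrA.
Qed.

Lemma co_slice_mull (phi : A -> F) t a x : scalar phi ->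
  co C (slice_r phi (tens_mul (pure 1 a) t)) x =
  \sum_y co C2 t (x, y) * phi (a * ba C y).
Proof.
move=> lphi; rewrite tens_mul_purel (tens_lift_co C C); last first.
  exact: bilinear_comp (bilinear_pure _ _) (bilinear_mul.1 1) (bilinear_mul.1 a).
rewrite (linear_lincomb (linear_slice_r _)) co_sum.
under eq_bigr do rewrite slice_r_pure // mul1r coZ.
rewrite -(pair_bigA _ (fun x' y => co C2 t (x', y) *
   (phi (a * ba C y) * co C (ba C x') x))) exchange_big.
apply: eq_bigr => y _; rewrite -[RHS](sum_co_ba C (fun x => _ t (x, y) * _)).
by apply: eq_bigr => x' _; rewrite mulrA.
Qed.

End TensorAlgebra.

(** * Squares *)

Section Squares.
Variable G : groupType.
Local Open Scope group_scope.

(** All four edges are kept as data, although two adjacent ones determine the square. This makes the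
    axioms symmetric in (h, k) and (v, u), so that [swap] only permutes them. *)
Record squares := Squares {
  sq_carrier :> finType;
  sq_H : {pred G};
  sq_K : {pred G};
  sq_Hgroup : group_closed sq_H;
  sq_Kgroup : group_closed sq_K;
  sq_trivial : forall g, g \in sq_H -> g \in sq_K -> g = 1;
  sh : sq_carrier -> G;
  sk : sq_carrier -> G;
  sv : sq_carrier -> G;
  su : sq_carrier -> G;
  sq_spec : forall x, [/\ sh x \in sq_H, sk x \in sq_K, sv x \in sq_K,
                           su x \in sq_H & sh x * sk x = sv x * su x];
  sq_inj : forall x y,
    sh x = sh y -> sk x = sk y -> sv x = sv y -> su x = su y -> x = y;
  sq_ex : forall h k v u, h \in sq_H -> k \in sq_K -> v \in sq_K -> u \in sq_H ->
    h * k = v * u -> exists x, [/\ sh x = h, sk x = k, sv x = v & su x = u] }.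

Lemma swap_spec (s : squares) (x : s) :
  [/\ sv x \in sq_K s, su x \in sq_H s, sh x \in sq_H s, sk x \in sq_K s &
      sv x * su x = sh x * sk x].
Proof. by have [] := sq_spec x. Qed.

Lemma swap_inj (s : squares) (x y : s) :
  sv x = sv y -> su x = su y -> sh x = sh y -> sk x = sk y -> x = y.
Proof. by move=> v u h k; apply: sq_inj. Qed.

Lemma swap_ex (s : squares) v u h k :
  v \in sq_K s -> u \in sq_H s -> h \in sq_H s -> k \in sq_K s ->
  v * u = h * k -> exists x : s, [/\ sv x = v, su x = u, sh x = h & sk x = k].
Proof. by move=> vK uH hH kK /esym /(sq_ex hH kK vK uH) [x [? ? ? ?]]; exists x. Qed.

Definition swap (s : squares) : squares :=
  Squares (sq_Kgroup s) (sq_Hgroup s) (fun g k h => sq_trivial h k)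
    (@swap_spec s) (@swap_inj s) (@swap_ex s).

(** Partial product of a groupoid with objects in [sq_H], where [x] is an arrow from [sh x] to
    [su x]; [None] stands for arrows that do not compose. For [comp2] the objects are in [sq_K] and
    [x] goes from [sv x] to [sk x]. *)
Definition comp1 (s : squares) (x y : s) : option s :=
  if su x == sh y then
    [pick z : s | [&& sh z == sh x, sk z == sk x * sk y,
                      sv z == sv x * sv y & su z == su y]]
  else None.

Definition comp2 (s : squares) : s -> s -> option s := @comp1 (swap s).

(** The inverse arrow; by [inv1P] the default value is never what makes the edges come out. *)
Definition inv1 (s : squares) (x : s) : s :=
  odflt x [pick z : s | [&& sh z == su x, sk z == (sk x)^-1,
                            sv z == (sv x)^-1 & su z == sh x]].

Definition inv2 (s : squares) : s -> s := @inv1 (swap s).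

(** One edge suffices: by [unit1_vu] the opposite edge is then trivial too and the other two agree,
    so these are the identity arrows. *)
Definition unit1 (s : squares) (x : s) : bool := sk x == 1.

Definition unit2 (s : squares) : s -> bool := @unit1 (swap s).

End Squares.

Lemma eq_option (T : eqType) (o1 o2 : option T) :
  (forall z, o1 = Some z <-> o2 = Some z) -> o1 = o2.
Proof.
case: o1 o2 => [x|] [y|] // E; first by apply/esym/E.
  by apply/esym/E.
by apply/E.
Qed.

Section Theory.
Variable G : groupType.
Local Open Scope group_scope.

(** * A square is determined by any of its corners *)

Section Corners.
Variable s : squares G.
Implicit Types (x y z : s).

Lemma sq_H1 : 1 \in sq_H s. Proof. by case: (sq_Hgroup s). Qed.
Lemma sq_HM a b : a \in sq_H s -> b \in sq_H s -> a * b \in sq_H s.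
Proof. exact: (group_closedM (sq_Hgroup s)). Qed.
Lemma sq_HV a : a \in sq_H s -> a^-1 \in sq_H s.
Proof. exact: (group_closedV (sq_Hgroup s)). Qed.

Lemma shH x : sh x \in sq_H s. Proof. by case: (sq_spec x). Qed.
Lemma skK x : sk x \in sq_K s. Proof. by case: (sq_spec x). Qed.
Lemma svK x : sv x \in sq_K s. Proof. by case: (sq_spec x). Qed.
Lemma suH x : su x \in sq_H s. Proof. by case: (sq_spec x). Qed.
Lemma sqE x : sh x * sk x = sv x * su x. Proof. by case: (sq_spec x). Qed.
End Corners.

Definition sq_K1 (s : squares G) : 1 \in sq_K s := sq_H1 (swap s).
Definition sq_KM (s : squares G) a b :
  a \in sq_K s -> b \in sq_K s -> a * b \in sq_K s := @sq_HM (swap s) a b.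
Definition sq_KV (s : squares G) a : a \in sq_K s -> a^-1 \in sq_K s :=
  @sq_HV (swap s) a.

(** Equality of the products places [h'^-1 * h = k' * k^-1] in both subgroups. *)
Lemma HK_inj (s : squares G) h h' k k' : h \in sq_H s -> h' \in sq_H s ->
  k \in sq_K s -> k' \in sq_K s -> h * k = h' * k' -> h = h' /\ k = k'.
Proof.
move=> hH h'H kK k'K E.
have E' : h'^-1 * h = k' * k^-1.
  by apply: (mulIg k); rewrite -mulgA E mulKg mulgVK.
have e1 : h'^-1 * h = 1.
  apply: (sq_trivial (s := s)); first by apply: sq_HM => //; apply: sq_HV.
  by rewrite E'; apply: sq_KM => //; apply: sq_KV.
have eh : h = h' by apply: (mulgI h'^-1); rewrite e1 mulVg.
by split=> //; move: E; rewrite eh => /mulgI.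
Qed.

Lemma corner_hk (s : squares G) (x y : s) :
  sh x = sh y -> sk x = sk y -> x = y.
Proof.
move=> eh ek; have := sqE x; rewrite eh ek sqE => /esym E.
have [ev eu] := HK_inj (s := swap s) (svK x) (svK y) (suH x) (suH y) E.
exact: sq_inj.
Qed.

Lemma corner_vu (s : squares G) (x y : s) :
  sv x = sv y -> su x = su y -> x = y.
Proof. exact: (corner_hk (s := swap s)). Qed.

(** The relation of the square read along its other diagonal; unique factorization then applies to
    the corners (h, v) and (k, u) as well. *)
Lemma sqVE (s : squares G) (x : s) : (sh x)^-1 * sv x = sk x * (su x)^-1.
Proof. by apply: (mulgI (sh x)); rewrite mulVKg mulgA sqE mulgK. Qed.

Lemma corner_hv (s : squares G) (x y : s) :
  sh x = sh y -> sv x = sv y -> x = y.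
Proof.
move=> eh ev; have := sqVE x; rewrite eh ev sqVE => /esym E.
have [ek /invg_inj eu] := HK_inj (s := swap s)
  (skK x) (skK y) (sq_HV (suH x)) (sq_HV (suH y)) E.
exact: sq_inj.
Qed.

Lemma corner_ku (s : squares G) (x y : s) :
  sk x = sk y -> su x = su y -> x = y.
Proof.
move=> ek eu; have := sqVE x; rewrite ek eu -sqVE => E.
have [/invg_inj eh ev] := HK_inj
  (sq_HV (shH x)) (sq_HV (shH y)) (svK x) (svK y) E.
exact: sq_inj.
Qed.

(** * The two groupoid structures on squares *)

Section Groupoid.
Variable s : squares G.
Implicit Types (x y z : s).

Lemma comp1P x y z : comp1 x y = Some z <->
  [/\ su x = sh y, sh z = sh x, sk z = sk x * sk y, sv z = sv x * sv y &
      su z = su y].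
Proof.
rewrite /comp1; case: eqP => [E|N]; last by split=> // -[].
case: pickP => [z' /and4P[/eqP eh /eqP ek /eqP ev /eqP eu]|N].
  split=> [[<-]|[_ eh' ek' ev' eu']] //; congr Some.
  by apply: sq_inj; rewrite ?eh ?ek ?ev ?eu.
split=> // -[_ eh ek ev eu].
by have := N z; rewrite eh ek ev eu !eqxx.
Qed.

Lemma comp1_ex x y : su x = sh y -> exists z, comp1 x y = Some z.
Proof.
move=> E; have [|||z [eh ek ev eu]] := @sq_ex _ s (sh x) (sk x * sk y)
  (sv x * sv y) (su y) (shH x) _ _ (suH y).
- by apply: sq_KM; apply: skK.
- by apply: sq_KM; apply: svK.
- by rewrite mulgA sqE -!mulgA -sqE E.
by exists z; apply/comp1P.
Qed.

Lemma inv1P x : [/\ sh (inv1 x) = su x, sk (inv1 x) = (sk x)^-1,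
  sv (inv1 x) = (sv x)^-1 & su (inv1 x) = sh x].
Proof.
rewrite /inv1; case: pickP => [z /and4P[/eqP ? /eqP ? /eqP ? /eqP ?] //|N].
have [|||z [eh ek ev eu]] := @sq_ex _ s (su x) (sk x)^-1 (sv x)^-1 (sh x)
  (suH x) _ _ (shH x).
- by apply: sq_KV; apply: skK.
- by apply: sq_KV; apply: svK.
- by apply: (mulgI (sv x)); rewrite mulVKg mulgA -sqE mulgK.
by have := N z; rewrite eh ek ev eu !eqxx.
Qed.

Lemma sh_inv1 x : sh (inv1 x) = su x. Proof. by case: (inv1P x). Qed.
Lemma sk_inv1 x : sk (inv1 x) = (sk x)^-1. Proof. by case: (inv1P x). Qed.
Lemma sv_inv1 x : sv (inv1 x) = (sv x)^-1. Proof. by case: (inv1P x). Qed.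
Lemma su_inv1 x : su (inv1 x) = sh x. Proof. by case: (inv1P x). Qed.
Definition inv1E := (sh_inv1, sk_inv1, sv_inv1, su_inv1).

Lemma inv1K : involutive (@inv1 G s).
Proof. by move=> x; apply: sq_inj; rewrite !inv1E ?invgK. Qed.

End Groupoid.

Section Second.
Variable s : squares G.
Implicit Types (x y z : s).

Lemma sh_inv2 x : sh (inv2 x) = (sh x)^-1.
Proof. exact: (sv_inv1 (s := swap s)). Qed.
Lemma sk_inv2 x : sk (inv2 x) = sv x.
Proof. exact: (su_inv1 (s := swap s)). Qed.
Lemma sv_inv2 x : sv (inv2 x) = sk x.
Proof. exact: (sh_inv1 (s := swap s)). Qed.
Lemma su_inv2 x : su (inv2 x) = (su x)^-1.
Proof. exact: (sk_inv1 (s := swap s)). Qed.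
Definition inv2E := (sh_inv2, sk_inv2, sv_inv2, su_inv2).

Lemma comp2P x y z : comp2 x y = Some z <->
  [/\ sk x = sv y, sv z = sv x, su z = su x * su y, sh z = sh x * sh y &
      sk z = sk y].
Proof. exact: (comp1P (s := swap s)). Qed.

Lemma comp2_ex x y : sk x = sv y -> exists z, comp2 x y = Some z.
Proof. exact: (comp1_ex (s := swap s)). Qed.

Lemma inv2K : involutive (@inv2 G s).
Proof. exact: (inv1K (s := swap s)). Qed.

Lemma inv12C x : inv1 (inv2 x) = inv2 (inv1 x).
Proof. by apply: sq_inj; rewrite !(inv1E, inv2E). Qed.

Lemma unit1P x : reflect (sk x = 1) (unit1 x). Proof. exact: eqP. Qed.
Lemma unit2P x : reflect (su x = 1) (unit2 x). Proof. exact: eqP. Qed.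

Lemma unit1_vu x : unit1 x -> sv x = 1 /\ su x = sh x.
Proof.
move/unit1P=> k1; have := sqE x; rewrite k1 mulg1 -{1}[sh x]mul1g => /esym E.
exact: (HK_inj (s := swap s) (svK x) (sq_K1 s) (suH x) (shH x) E).
Qed.

Lemma unit1_sv x : unit1 x = (sv x == 1).
Proof.
apply/idP/eqP => [/unit1_vu[]//|v1]; apply/eqP.
have := sqE x; rewrite v1 mul1g -[su x]mulg1 => E.
by case: (HK_inj (shH x) (suH x) (skK x) (sq_K1 s) E).
Qed.

End Second.

(** The shape of the product of C(Omega): the second factor sits at $(h\triangleleft v, v^{-1}k)$
    when the first sits at $(h,v)$. *)
Lemma comp1_hk (s : squares G) (x y z : s) : comp1 x y = Some z <->
  [/\ sh x = sh z, sh y = su x & sk y = (sk x)^-1 * sk z].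
Proof.
split=> [/comp1P[e1 e2 e3 _ _]|[e1 e2 e3]].
  by split=> //; apply: (mulgI (sk x)); rewrite -e3 mulVKg.
have [w Ew] := comp1_ex (esym e2); rewrite Ew; congr Some.
have [_ f1 f2 _ _] := (comp1P _ _ _).1 Ew.
by apply: corner_hk; rewrite ?f1 // f2 e3 mulVKg.
Qed.

(** The shape of the product of the other algebra: the first factor sits at $(hu^{-1},
    u\triangleright k)$ when the second sits at $(u,k)$. *)
Lemma comp2_hk (s : squares G) (x y z : s) : comp2 x y = Some z <->
  [/\ sk y = sk z, sk x = sv y & sh x = sh z * (sh y)^-1].
Proof.
split=> [/comp2P[e1 _ _ e2 e3]|[e1 e2 e3]].
  by split=> //; apply: (mulIg (sh y)); rewrite -e2 mulgVK.
have [w Ew] := comp2_ex e2; rewrite Ew; congr Some.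
have [_ _ _ f1 f2] := (comp2P _ _ _).1 Ew.
by apply: corner_hk; rewrite ?f2 // f1 e3 mulgVK.
Qed.

Section FirstComposition.
Variable s : squares G.
Implicit Types (x y z : s).

Lemma unit2_sh x : unit2 x = (sh x == 1).
Proof. exact: (unit1_sv (s := swap s)). Qed.

(** For a partial operation both sides must also be undefined together, so each direction has to
    construct the other intermediate composite. *)
Lemma comp1A x y z :
  obind (fun w => comp1 w z) (comp1 x y) = obind (comp1 x) (comp1 y z).
Proof.
apply: eq_option => r; split.
  case E: (comp1 x y) => [w|] //= /comp1P[e1 e2 e3 e4 e5].
  have [f1 f2 f3 f4 f5] := (comp1P _ _ _).1 E.
  have [t Et] : exists t, comp1 y z = Some t by apply: comp1_ex; rewrite -f5.
  have [g1 g2 g3 g4 g5] := (comp1P _ _ _).1 Et.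
  rewrite Et /=; apply/comp1P; split; rewrite ?g2 ?g3 ?g4 ?g5 //.
  - by rewrite e2.
  - by rewrite e3 f3 mulgA.
  - by rewrite e4 f4 mulgA.
case E: (comp1 y z) => [w|] //= /comp1P[e1 e2 e3 e4 e5].
have [f1 f2 f3 f4 f5] := (comp1P _ _ _).1 E.
have [t Et] : exists t, comp1 x y = Some t by apply: comp1_ex; rewrite -f2.
have [g1 g2 g3 g4 g5] := (comp1P _ _ _).1 Et.
rewrite Et /=; apply/comp1P; split; rewrite ?g2 ?g3 ?g4 ?g5 //.
- by rewrite e3 f3 mulgA.
- by rewrite e4 f4 mulgA.
- by rewrite e5.
Qed.

Lemma unit1_ex h : h \in sq_H s -> exists2 e : s, unit1 e & sh e = h.
Proof.
move=> hH; have [|e [eh ek _ _]] :=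
  @sq_ex _ s h 1 1 h hH (sq_K1 s) (sq_K1 s) hH; first by rewrite mulg1 mul1g.
by exists e => //; apply/unit1P.
Qed.

(** Exactly one identity composes with [y] on the left. Applied to [swap s], this yields the counit
    property. *)
Lemma comp1_unitl y : exists2 e, unit1 e & forall x, unit1 x ->
  comp1 x y = if x == e then Some y else None.
Proof.
have [e e1 eh] := unit1_ex (shH y); exists e => // x x1.
have [xv xu] := unit1_vu x1; have [ev eu] := unit1_vu e1.
case: eqP => [->|N].
  apply/comp1P; rewrite eu eh ev !mul1g; split=> //.
  by rewrite (eqP e1) mul1g.
case E: (comp1 x y) => [z|] //; case: N; apply: corner_hk.
  by have [] := (comp1P _ _ _).1 E; rewrite eh -xu.
by rewrite (eqP x1) (eqP e1).
Qed.

Lemma comp1_unitr x : exists2 e, unit1 e & forall y, unit1 y ->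
  comp1 x y = if y == e then Some x else None.
Proof.
have [e e1 eh] := unit1_ex (suH x); exists e => // y y1.
have [yv yu] := unit1_vu y1; have [ev eu] := unit1_vu e1.
case: eqP => [->|N].
  apply/comp1P; rewrite eu eh ev !mulg1; split=> //.
  by rewrite (eqP e1) mulg1.
case E: (comp1 x y) => [z|] //; case: N; apply: corner_hk.
  by have [] := (comp1P _ _ _).1 E; rewrite eh.
by rewrite (eqP y1) (eqP e1).
Qed.

Lemma comp1_unit1 x y : oapp (@unit1 G s) false (comp1 x y) = (y == inv1 x).
Proof.
apply/idP/eqP => [|->].
  case E: (comp1 x y) => [z|] //= /unit1P z1.
  have [e1 e2 e3 e4 e5] := (comp1P _ _ _).1 E.
  apply: corner_hk; rewrite inv1E //.
  by apply: (mulgI (sk x)); rewrite -e3 z1 mulgV.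
have [z Ez] : exists z, comp1 x (inv1 x) = Some z by apply: comp1_ex; rewrite inv1E.
have [_ _ e _ _] := (comp1P _ _ _).1 Ez.
by rewrite Ez /=; apply/unit1P; rewrite e inv1E mulgV.
Qed.

(** A second-type unit has both H-edges trivial, and composable squares share an H-edge, so
    triviality propagates. This makes the counit multiplicative; after [swap] it gives the coproduct
    of 1. *)
Lemma comp1_unit2 x y :
  oapp (@unit2 G s) false (comp1 x y) = unit2 x && unit2 y.
Proof.
apply/idP/andP => [|[/unit2P x1]].
  case E: (comp1 x y) => [z|] //= /unit2P z1.
  have [e1 e2 e3 e4 e5] := (comp1P _ _ _).1 E.
  have y1 : unit2 y by apply/unit2P; rewrite -e5.
  by split=> //; apply/unit2P; rewrite e1; apply/eqP; rewrite -unit2_sh.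
move=> y1; have [z Ez] : exists z, comp1 x y = Some z.
  by apply: comp1_ex; rewrite x1; apply/esym/eqP; rewrite -unit2_sh.
have [_ _ _ _ e] := (comp1P _ _ _).1 Ez.
by rewrite Ez /=; apply/unit2P; rewrite e; apply/unit2P.
Qed.

Lemma comp1_inv1 x y z : comp1 (inv1 x) y = Some z <-> comp1 x z = Some y.
Proof.
rewrite !comp1P !inv1E; split=> -[e1 e2 e3 e4 e5]; split; rewrite ?e1 ?e3 ?e4 //;
  by rewrite ?mulKg ?mulVKg.
Qed.

Lemma inv1_comp1 x y : comp1 (inv1 y) (inv1 x) = omap (@inv1 G s) (comp1 x y).
Proof.
apply: eq_option => z; case E: (comp1 x y) => [t|] /=.
  have [f1 f2 f3 f4 f5] := (comp1P _ _ _).1 E.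
  rewrite comp1P !inv1E; split=> [[e1 e2 e3 e4 e5]|[<-]].
    by congr Some; apply: sq_inj; rewrite !inv1E ?f2 ?f3 ?f4 ?f5 ?invgM.
  by rewrite !inv1E f2 f3 f4 f5 !invgM; split.
split=> // /comp1P; rewrite !inv1E => -[/esym /comp1_ex [t]].
by rewrite E.
Qed.

(** [inv2] preserves the first composition while [inv1] reverses it. Hence their composite reverses
    it, which makes the antipode an anti-isomorphism. *)
Lemma inv2_comp1 x y : comp1 (inv2 x) (inv2 y) = omap (@inv2 G s) (comp1 x y).
Proof.
apply: eq_option => z; case E: (comp1 x y) => [t|] /=.
  have [f1 f2 f3 f4 f5] := (comp1P _ _ _).1 E.
  rewrite comp1P !inv2E; split=> [[e1 e2 e3 e4 e5]|[<-]].
    by congr Some; apply: sq_inj; rewrite !inv2E ?f2 ?f3 ?f4 ?f5 //.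
  by rewrite !inv2E f2 f3 f4 f5 f1; split.
split=> // /comp1P; rewrite !inv2E => -[/invg_inj /comp1_ex [t]].
by rewrite E.
Qed.

Lemma unit1_inv1 x : unit1 (inv1 x) = unit1 x.
Proof. by rewrite /unit1 inv1E -[in LHS]invg1 (inj_eq invg_inj). Qed.

Lemma unit1_inv2 x : unit1 (inv2 x) = unit1 x.
Proof. by rewrite [RHS]unit1_sv /unit1 inv2E. Qed.

(** Only the square with trivial edges is an identity for both compositions; this gives the value 1
    of the counit at 1. *)
Lemma unit12 : exists e : s, forall x, unit1 x && unit2 x = (x == e).
Proof.
have [e e1 eh] := unit1_ex (sq_H1 s); exists e => x; rewrite unit2_sh.
apply/andP/eqP => [[/eqP x1 /eqP xh]|->]; last by rewrite eh e1.
by apply: corner_hk; rewrite ?eh // x1 (eqP e1).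
Qed.

End FirstComposition.

Section SecondComposition.
Variable s : squares G.
Implicit Types (x y z : s).

Lemma comp2A x y z :
  obind (fun w => comp2 w z) (comp2 x y) = obind (comp2 x) (comp2 y z).
Proof. exact: (comp1A (s := swap s)). Qed.

Lemma comp2_unitl y : exists2 e, unit2 e & forall x, unit2 x ->
  comp2 x y = if x == e then Some y else None.
Proof. exact: (comp1_unitl (s := swap s)). Qed.

Lemma comp2_unitr x : exists2 e, unit2 e & forall y, unit2 y ->
  comp2 x y = if y == e then Some x else None.
Proof. exact: (comp1_unitr (s := swap s)). Qed.

Lemma comp2_unit1 x y :
  oapp (@unit1 G s) false (comp2 x y) = unit1 x && unit1 y.
Proof. exact: (comp1_unit2 (s := swap s)). Qed.

Lemma comp2_inv2 x y z : comp2 (inv2 x) y = Some z <-> comp2 x z = Some y.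
Proof. exact: (comp1_inv1 (s := swap s)). Qed.

Lemma inv1_comp2 x y : comp2 (inv1 x) (inv1 y) = omap (@inv1 G s) (comp2 x y).
Proof. exact: (inv2_comp1 (s := swap s)). Qed.

End SecondComposition.

(** * Full sets of squares, interchange and the antipode equations *)

Definition full (s : squares G) :=
  (forall h k, h \in sq_H s -> k \in sq_K s ->
     exists x : s, sh x = h /\ sk x = k) /\
  (forall v u, v \in sq_K s -> u \in sq_H s ->
     exists x : s, sv x = v /\ su x = u).

Section Full.
Variable s : squares G.
Implicit Types (x y z p q : s) (m n : s * s).

(** A two by two grid with entries [m.1], [m.2], [n.1], [n.2]: the second composition joins the two
    members of a pair, the first joins [m] to [n]. *)
Definition subdivision p q x y m n :=
  [/\ comp2 m.1 m.2 = Some p, comp2 n.1 n.2 = Some q,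
      comp1 m.1 n.1 = Some x & comp1 m.2 n.2 = Some y].

Lemma interchange p q x y m n : subdivision p q x y m n ->
  exists z, comp2 x y = Some z /\ comp1 p q = Some z.
Proof.
case=> /comp2P[a1 a2 a3 a4 a5] /comp2P[b1 b2 b3 b4 b5].
case=> /comp1P[c1 c2 c3 c4 c5] /comp1P[d1 d2 d3 d4 d5].
have [z Ez] : exists z, comp2 x y = Some z.
  by apply: comp2_ex; rewrite c3 d4 a1 b1.
exists z; split=> //; have [e1 e2 e3 e4 e5] := (comp2P _ _ _).1 Ez.
apply/comp1P; split.
- by rewrite a3 b4 c1 d1.
- by rewrite e4 c2 d2 a4.
- by rewrite e5 d3 a5 b5.
- by rewrite e2 c4 a2 b2.
- by rewrite e3 c5 d5 b3.
Qed.

(** Each of the four small squares has two adjacent edges on the boundary of the grid, and for each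
    it is a different corner; all four corner lemmas are used. *)
Lemma subdivision_uniq p q x y m n m' n' :
  subdivision p q x y m n -> subdivision p q x y m' n' -> m = m' /\ n = n'.
Proof.
case: m n m' n' => [m1 m2] [n1 n2] [m1' m2'] [n1' n2'] [].
move=> /comp2P[/= _ a2 _ _ a5] /comp2P[/= _ b2 _ _ b5].
move=> /comp1P[/= _ c2 _ _ c5] /comp1P[/= _ d2 _ _ d5] [].
move=> /comp2P[/= _ a2' _ _ a5'] /comp2P[/= _ b2' _ _ b5'].
move=> /comp1P[/= _ c2' _ _ c5'] /comp1P[/= _ d2' _ _ d5'].
split; congr pair.
- by apply: corner_hv; rewrite -?c2 -?a2.
- by apply: corner_hk; rewrite -?d2 -?a5.
- by apply: corner_vu; rewrite -?b2 -?c5.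
- by apply: corner_ku; rewrite -?b5 -?d5.
Qed.

Lemma subdivision_ex p q x y z : full s ->
  comp2 x y = Some z -> comp1 p q = Some z ->
  exists m n, subdivision p q x y m n.
Proof.
move=> [fhk _] /comp2P[e1 e2 e3 e4 e5] /comp1P[f1 f2 f3 f4 f5].
(* The grid grows from the corner (h, k): [c] gets its edges from the boundary, [a] and [d] each
   share one edge with [c], and [b] shares one with each of [a] and [d]. That the composites are the
   given squares is then checked on (h, k). *)
have [c [ch ck]] := fhk _ _ (shH y) (skK p).
have [a [ah ak]] := fhk _ _ (shH x) (svK c).
have [d [dh dk]] := fhk _ _ (suH c) (skK q).
have [b [bh bk]] := fhk _ _ (suH a) (svK d).
have [p' Ep] := comp2_ex ak; have [g1 g2 g3 g4 g5] := (comp2P _ _ _).1 Ep.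
have Dp : p' = p by apply: corner_hk; rewrite ?g4 ?g5 // ah ch -e4.
have [y' Ey] := comp1_ex (esym dh); have [h1 h2 h3 h4 h5] := (comp1P _ _ _).1 Ey.
have Dy : y' = y by apply: corner_hk; rewrite ?h2 ?h3 // ck dk -f3.
have [x' Ex] := comp1_ex (esym bh); have [i1 i2 i3 i4 i5] := (comp1P _ _ _).1 Ex.
have Dx : x' = x.
  by apply: corner_hk; rewrite ?i2 ?i3 // ak bk -h4 Dy -e1.
have [q' Eq] := comp2_ex bk; have [j1 j2 j3 j4 j5] := (comp2P _ _ _).1 Eq.
have Dq : q' = q.
  by apply: corner_hk; rewrite ?j4 ?j5 // bh dh -g3 Dp f1.
exists (a, c), (b, d); split; rewrite /= ?Ep ?Eq ?Ex ?Ey; by congr Some.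
Qed.

(** [inv2] turns an (h, k) corner into an (h, v) corner, inverting the H-edge. *)
Lemma corner_ex_hv h v : full s -> h \in sq_H s -> v \in sq_K s ->
  exists x : s, sh x = h /\ sv x = v.
Proof.
move=> [fhk _] hH vK; have [x [xh xk]] := fhk _ _ (sq_HV hH) vK.
by exists (inv2 x); rewrite !inv2E xh invgK.
Qed.

(** These pairs are the terms of [S(a_1) a_2]. Composability forces [y = inv2 x], and the corner (v,
    u) of [x] is then prescribed by [r] and [z]. *)
Lemma antipode_comp_l r z x y :
  comp2 x y = Some r /\ comp1 (inv1 (inv2 x)) y = Some z <->
  [/\ unit2 r, unit1 z, y = inv2 x, sv x = sk r & su x = (sh z)^-1].
Proof.
split=> [[/comp2P[e1 e2 e3 e4 e5] /comp1P[f1 f2 f3 f4 f5]]|].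
  rewrite !(inv1E, inv2E) in f1 f2 f3 f4.
  have Ey : y = inv2 x by apply: corner_hv; rewrite !inv2E.
  split=> //.
  - by rewrite unit2_sh e4 -f1 mulgV.
  - by apply/unit1P; rewrite f3 Ey inv2E mulVg.
  - by rewrite e5 Ey inv2E.
  - by rewrite f2 invgK.
move=> [r2 z1 -> xv xu]; have [zv zu] := unit1_vu z1.
have rh : sh r = 1 by apply/eqP; rewrite -unit2_sh.
have rv : sv r = sk r.
  by have := sqE r; rewrite (unit2P _ r2) rh mulg1 mul1g.
split; [apply/comp2P|apply/comp1P]; rewrite !(inv1E, inv2E); split=> //.
- by rewrite rv.
- by rewrite mulgV (unit2P _ r2).
- by rewrite mulgV.
- by rewrite xu invgK.
- by rewrite mulVg (unit1P _ z1).
- by rewrite zv mulVg.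
- by rewrite zu xu invgK.
Qed.

(** The terms of [a_1 S(a_2)]; here the corner (h, v) of [x] is the one prescribed. *)
Lemma antipode_comp_r r z x y :
  comp2 x y = Some r /\ comp1 x (inv1 (inv2 y)) = Some z <->
  [/\ unit2 r, unit1 z, y = inv2 x, sv x = sk r & sh x = sh z].
Proof.
split=> [[/comp2P[e1 e2 e3 e4 e5] /comp1P[f1 f2 f3 f4 f5]]|].
  rewrite !(inv1E, inv2E) in f1 f3 f4 f5.
  have Ey : y = inv2 x by apply: corner_vu; rewrite !inv2E // f1 invgK.
  split=> //.
  - by apply/unit2P; rewrite e3 Ey inv2E mulgV.
  - by apply/unit1P; rewrite f3 -e1 mulgV.
  - by rewrite e5 Ey inv2E.
move=> [r2 z1 -> xv xh]; have [zv zu] := unit1_vu z1.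
have rh : sh r = 1 by apply/eqP; rewrite -unit2_sh.
have rv : sv r = sk r.
  by have := sqE r; rewrite (unit2P _ r2) rh mulg1 mul1g.
split; [apply/comp2P|apply/comp1P]; rewrite !(inv1E, inv2E) ?invgK; split=> //.
- by rewrite rv.
- by rewrite mulgV (unit2P _ r2).
- by rewrite mulgV.
- by rewrite mulgV (unit1P _ z1).
- by rewrite zv mulgV.
- by rewrite zu.
Qed.

End Full.

End Theory.

(** * The algebra of a set of squares *)

(** Partial compositions enter the sums as 0-1 coefficients; this passes between such a sum and the
    value at the composite, with 0 if there is none. *)
Lemma sum_some (F : pzSemiRingType) (X : finType) (o : option X) (f : X -> F) :
  \sum_z (o == Some z)%:R * f z = oapp f 0 o.
Proof.
case: o => [x|] /=; last by rewrite big1 // => z _; rewrite mul0r.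
rewrite (bigD1 x) //= eqxx mul1r big1 ?addr0 // => z zx.
rewrite (_ : Some x == Some z = false) ?mul0r //; apply: contraNF zx => /eqP[->].
by rewrite eqxx.
Qed.

Lemma sum_eq1 (F : pzSemiRingType) (X : finType) (x : X) (f : X -> F) :
  \sum_z (x == z)%:R * f z = f x.
Proof.
rewrite (bigD1 x) //= eqxx mul1r big1 ?addr0 // => z /negPf zx.
by rewrite eq_sym zx mul0r.
Qed.

Lemma exchange_big2 (V : nmodType) (I J K L : finType)
    (f : I -> J -> K -> L -> V) :
  \sum_i \sum_j \sum_k \sum_l f i j k l = \sum_k \sum_l \sum_i \sum_j f i j k l.
Proof.
transitivity (\sum_i \sum_k \sum_j \sum_l f i j k l).
  by apply: eq_bigr => i _; exact: exchange_big.
rewrite exchange_big; apply: eq_bigr => k _.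
transitivity (\sum_i \sum_l \sum_j f i j k l).
  by apply: eq_bigr => i _; exact: exchange_big.
exact: exchange_big.
Qed.

Section SquareAlgebra.
Variables (F : numClosedFieldType) (A : falgType F) (G : groupType).
Variables (s : squares G) (C : coords A s).
Hypothesis co_mul : forall a b z, co C (a * b) z =
  \sum_(p : s * s) (comp1 p.1 p.2 == Some z)%:R * (co C a p.1 * co C b p.2).
Hypothesis co_one : forall x, co C 1 x = (unit1 x)%:R.
Local Notation C2 := (tensor_coords C C).

(** The transpose of the convolution product for [comp2]; the default 0 accounts for pairs that do
    not compose. *)
Definition cop (a : A) : tensor A A :=
  of_co C2 (fun p => oapp (co C a) 0 (comp2 p.1 p.2)).

Definition antipode (a : A) : A := of_co C (fun x => co C a (inv1 (inv2 x))).

(** The canonical trace of a groupoid algebra, summing over the identities of the first groupoid. *)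
Definition integral (a : A) : F := \sum_x (unit1 x)%:R * co C a x.

Lemma co_cop a p : co C2 (cop a) p = oapp (co C a) 0 (comp2 p.1 p.2).
Proof. exact: of_coK. Qed.

Lemma co_antipode a x : co C (antipode a) x = co C a (inv1 (inv2 x)).
Proof. exact: of_coK. Qed.

Lemma sum_co_mul (f : s -> F) a b : \sum_z f z * co C (a * b) z =
  \sum_(p : s * s) oapp f 0 (comp1 p.1 p.2) * (co C a p.1 * co C b p.2).
Proof.
under eq_bigr do rewrite co_mul mulr_sumr.
rewrite exchange_big; apply: eq_bigr => p _; rewrite -sum_some mulr_suml.
by apply: eq_bigr => z _; rewrite !mulrA; congr (_ * _ * _); rewrite mulrC.
Qed.

Lemma co_mul_ba x y z : co C (ba C x * ba C y) z = (comp1 x y == Some z)%:R.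
Proof.
rewrite co_mul -(pair_bigA _ (fun x' y' => (comp1 x' y' == Some z)%:R *
  (co C (ba C x) x' * co C (ba C y) y'))) /=.
under eq_bigr do under eq_bigr do rewrite !co_ba mulrCA.
under eq_bigr do rewrite -mulr_sumr.
rewrite sum_eq1; under eq_bigr do rewrite mulrC.
by rewrite sum_eq1.
Qed.

(** A composite is an identity exactly when the second factor is the inverse of the first, so only
    the pairs [(x, inv1 x)] survive. *)
Lemma sum_unit1 (a b : A) :
  integral (a * b) = \sum_x co C a x * co C b (inv1 x).
Proof.
rewrite /integral sum_co_mul -(pair_bigA _ (fun x y =>
  oapp (fun z => (unit1 z)%:R) 0 (comp1 x y) * (co C a x * co C b y))) /=.
apply: eq_bigr => x _; rewrite -[RHS](sum_eq1 (inv1 x) (fun y => _ * co C b y)).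
apply: eq_bigr => y _; congr (_ * _); rewrite eq_sym -comp1_unit1.
by case: comp1.
Qed.

Lemma cop_linear : linear cop.
Proof.
move=> c a b; apply: (coP (C := C2)) => p; rewrite coPl !co_cop.
by case: comp2 => [z|] /=; rewrite ?coPl // mulr0 addr0.
Qed.

Lemma antipode_linear : linear antipode.
Proof. by move=> c a b; apply: (coP (C := C)) => x; rewrite coPl !co_antipode coPl. Qed.

Lemma integral_scalar : scalar integral.
Proof.
move=> c a b; rewrite /integral mulr_sumr -big_split; apply: eq_bigr => x _ /=.
by rewrite coPl mulrDr mulrCA.
Qed.

Lemma sum_oapp_ba (f : s -> F) (o : option s) :
  \sum_w f w * oapp (co C (ba C w)) 0 o = oapp f 0 o.
Proof.
case: o => [x|] /=; first exact: sum_co_ba.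
by rewrite big1 // => w _; rewrite mulr0.
Qed.

Lemma cop_coassoc : coassociative cop.
Proof.
move=> a; apply: (coP (C := tensor_coords C C2)) => -[x [y z]].
rewrite co_tens_assoc (co_tens_map C C C2 C _ _ cop_linear (@linear_id _ _)).
rewrite (co_tens_map C C C C2 _ _ (@linear_id _ _) cop_linear) /=.
transitivity (oapp (co C a) 0 (obind (fun w => comp2 w z) (comp2 x y))).
  under eq_bigr => w _.
    under eq_bigr do rewrite !co_cop mulrA.
    rewrite (sum_co_ba C (fun v => oapp _ 0 (comp2 w v) * _)) /=; over.
  by rewrite sum_oapp_ba; case: comp2.
rewrite comp2A exchange_big /=.
under eq_bigr => w _.
  under eq_bigr do rewrite !co_cop mulrA.
  rewrite -mulr_suml (sum_co_ba C (fun v => oapp _ 0 (comp2 v w))) /=; over.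
by rewrite sum_oapp_ba; case: comp2.
Qed.

(** Of the squares in [unit2] exactly one composes with [x] on a given side, and the composite is
    [x]. *)
Lemma cop_counital (eps : A -> F) : scalar eps ->
  (forall x, eps (ba C x) = (unit2 x)%:R) -> counital cop eps.
Proof.
move=> leps epsE a; split; apply: (coP (C := C)) => x.
  rewrite (co_slice_l C C) //; under eq_bigr do rewrite co_cop epsE mulrC /=.
  have [e e2 eE] := comp2_unitl x.
  rewrite (bigD1 e) //= e2 mul1r big1 ?addr0 => [|y /negPf ye].
    by rewrite eE // eqxx.
  have [y2|_] := boolP (unit2 y); last by rewrite mul0r.
  by rewrite eE // ye mulr0.
rewrite (co_slice_r C C) //; under eq_bigr do rewrite co_cop epsE mulrC /=.
have [e e2 eE] := comp2_unitr x.
rewrite (bigD1 e) //= e2 mul1r big1 ?addr0 => [|y /negPf ye].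
  by rewrite eE // eqxx.
have [y2|_] := boolP (unit2 y); last by rewrite mul0r.
by rewrite eE // ye mulr0.
Qed.

Lemma cop1 : cop 1 = pure 1 1.
Proof.
apply: (coP (C := C2)) => p; rewrite co_cop co_pure !co_one -natrM mulnb.
have := comp2_unit1 p.1 p.2.
by case: comp2 => [z|] /=; rewrite ?co_one => <-.
Qed.

Lemma inv12_comp1 x y :
  comp1 (inv1 (inv2 y)) (inv1 (inv2 x)) = omap (fun z : s => inv1 (inv2 z)) (comp1 x y).
Proof. by rewrite inv1_comp1 inv2_comp1; case: comp1. Qed.

Lemma inv12K : involutive (fun x : s => inv1 (inv2 x)).
Proof. by move=> x; rewrite inv12C inv1K inv2K. Qed.

(** Serves twice: with [inv1] after [inv2] for the antipode, and with [inv1] for the involution. *)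
Lemma co_mul_anti (t : s -> s) a b z : involutive t ->
    (forall x y, comp1 (t y) (t x) = omap t (comp1 x y)) ->
  co C (a * b) (t z) = \sum_(p : s * s) (comp1 p.1 p.2 == Some z)%:R *
    (co C b (t p.1) * co C a (t p.2)).
Proof.
move=> tK tE; rewrite co_mul.
rewrite (reindex_inj (h := fun p : s * s => (t p.2, t p.1))) /=; last first.
  by apply: (can_inj (g := fun p : s * s => (t p.2, t p.1))) => -[x y]; rewrite /= !tK.
apply: eq_bigr => -[x y] _ /=; congr (_%:R * _); last by rewrite mulrC.
rewrite tE; case: comp1 => [r|] //=.
by rewrite !(inj_eq (@Some_inj _)) (can_eq tK).
Qed.

Lemma antipodeK : involutive antipode.
Proof. by move=> a; apply: (coP (C := C)) => x; rewrite !co_antipode inv12K. Qed.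

Lemma antipode_anti : anti_isomorphism antipode.
Proof.
split.
- exact: antipode_linear.
- by exists antipode; apply: antipodeK.
- apply: (coP (C := C)) => x; rewrite co_antipode !co_one.
  by rewrite unit1_inv1 unit1_inv2.
move=> a b; apply: (coP (C := C)) => z.
rewrite co_antipode [LHS](co_mul_anti a b z inv12K inv12_comp1) co_mul.
by apply: eq_bigr => p _; rewrite !co_antipode.
Qed.

(** Multiplying by the basis vector at [inv1 x] and integrating extracts the coordinate at [x]. *)
Lemma integral_faithful : faithful integral.
Proof.
split=> [a a0|c c0]; apply: (coP (C := C)) => x; rewrite co0.
  rewrite -(a0 (ba C (inv1 x))) sum_unit1 -[LHS](sum_co_ba C (co C a)).
  by apply: eq_bigr => y _; rewrite !co_ba (can_eq (@inv1K G s)) eq_sym.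
rewrite -(c0 (ba C (inv1 x))) sum_unit1.
by rewrite (sum_co_bar C (fun y : s => co C c (inv1 y))) inv1K.
Qed.

(** [inv2 x] is cancelled to the other side in the second groupoid, and [inv1] is an automorphism of
    that groupoid. This is the combinatorial content of left invariance. *)
Lemma comp2_shift (x y z : s) :
  (comp2 (inv1 (inv2 x)) y == Some z) = (comp2 x (inv1 z) == Some (inv1 y)).
Proof.
have E : comp2 x (inv1 z) = omap (@inv1 G s) (comp2 (inv1 x) z).
  by rewrite -{1}[x]inv1K inv1_comp2.
have H := comp2_inv2 (inv1 x) y z; rewrite -inv12C in H.
apply/eqP/eqP => [/H|]; first by rewrite E => ->.
rewrite E; case E2: comp2 => [w|] //= [/(can_inj (@inv1K G s)) wy].
by apply/H; rewrite E2 wy.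
Qed.

Lemma integral_left : left_integral cop integral antipode.
Proof.
split; [exact: integral_scalar|exact: antipode_linear|move=> a c].
apply: (coP (C := C)) => x; rewrite co_antipode.
rewrite (co_slice_mulr C _ _ _ integral_scalar) (co_slice_mull C _ _ _ integral_scalar).
(* Both sides are brought to this double sum; on the right both summation variables are replaced by
   their [inv1]. *)
transitivity (\sum_y \sum_z (comp2 (inv1 (inv2 x)) y == Some z)%:R *
    (co C a z * co C c (inv1 y))).
  apply: eq_bigr => y _; rewrite co_cop /= -sum_some mulr_suml sum_unit1.
  rewrite (sum_co_bar C (fun y : s => co C c (inv1 y))).
  by apply: eq_bigr => z _; rewrite mulrA.
rewrite exchange_big [RHS](reindex_inj (can_inj (@inv1K G s))) /=.
apply: eq_bigr => z _; rewrite co_cop /= -sum_some mulr_suml sum_unit1.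
have -> : \sum_y co C a y * co C (ba C (inv1 z)) (inv1 y) = co C a z.
  rewrite -[RHS](sum_co_ba C (co C a)); apply: eq_bigr => y _.
  by rewrite !co_ba (can_eq (@inv1K G s)) eq_sym.
rewrite [RHS](reindex_inj (can_inj (@inv1K G s))) /=.
by apply: eq_bigr => y _; rewrite comp2_shift -!mulrA; congr (_ * _); rewrite mulrC.
Qed.

(** * Counit, quantum hypergroup structure, and the Hopf algebra of a full set of squares *)

Section Counit.
Variable eps : A -> F.
Hypothesis epsE : forall a, eps a = \sum_x co C a x * (unit2 x)%:R.

Lemma counit_scalar : scalar eps.
Proof.
move=> c a b; rewrite !epsE mulr_sumr -big_split; apply: eq_bigr => x _ /=.
by rewrite coPl mulrDl mulrA.
Qed.

Lemma counit_ba x : eps (ba C x) = (unit2 x)%:R.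
Proof. by rewrite epsE (sum_co_bar C (fun x : s => (unit2 x)%:R)). Qed.

Lemma counit_morphism : monoid_morphism eps.
Proof.
split=> [|a b].
  have [e eE] := unit12 s; rewrite epsE (bigD1 e) //= big1 => [|x /negPf xe].
    by rewrite co_one -natrM mulnb eE eqxx addr0.
  by rewrite co_one -natrM mulnb eE xe.
rewrite !epsE; under eq_bigr do rewrite mulrC.
rewrite sum_co_mul mulr_suml -(pair_bigA _ (fun x y =>
  oapp (fun z => (unit2 z)%:R) 0 (comp1 x y) * (co C a x * co C b y))) /=.
apply: eq_bigr => x _; rewrite mulr_sumr; apply: eq_bigr => y _.
rewrite mulrACA -natrM mulnb -comp1_unit2 [RHS]mulrC.
by case: comp1.
Qed.

Lemma squares_quantum_hypergroup : finite_quantum_hypergroup cop eps antipode.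
Proof.
split.
- by split; [exact: cop_linear|exact: cop_coassoc].
- by split; [exact: counit_scalar|apply: cop_counital counit_scalar counit_ba].
- exact: counit_morphism.
- exact: cop1.
- split; first exact: antipode_anti.
  by exists integral; [exact: integral_faithful|exact: integral_left].
Qed.

(** The left side counts subdivisions. There is none unless the two composites agree, by
    [interchange], and otherwise exactly one, by fullness and [subdivision_uniq]. *)
Lemma sum_subdivision (p q x y : s) : full s ->
  \sum_m \sum_n ((comp2 m.1 m.2 == Some p)%:R * (comp2 n.1 n.2 == Some q)%:R) *
      ((comp1 m.1 n.1 == Some x)%:R * (comp1 m.2 n.2 == Some y)%:R) =
  \sum_z (comp2 x y == Some z)%:R * (comp1 p q == Some z)%:R :> F.
Proof.
move=> fs; pose d (m n : s * s) :=
  ((comp2 m.1 m.2 == Some p) && (comp2 n.1 n.2 == Some q)) &&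
  ((comp1 m.1 n.1 == Some x) && (comp1 m.2 n.2 == Some y)).
have dP m n : reflect (subdivision p q x y m n) (d m n).
  apply: (iffP andP) => [[/andP[/eqP ? /eqP ?] /andP[/eqP ? /eqP ?]]|[-> -> -> ->]] //.
  by rewrite !eqxx.
transitivity (\sum_m \sum_n (d m n)%:R : F).
  by apply: eq_bigr => m _; apply: eq_bigr => n _; rewrite -!natrM !mulnb.
rewrite sum_some; case E: (comp2 x y) => [z|] /=; last first.
  rewrite big1 // => m _; rewrite big1 // => n _.
  by case: dP => // /interchange [z []]; rewrite E.
case: eqP => [E1|N]; last first.
  rewrite big1 // => m _; rewrite big1 // => n _.
  by case: dP => // /interchange [z' []]; rewrite E => -[<-] /N.
have [m [n mn]] := subdivision_ex fs E E1.
rewrite (bigD1 m) //= (bigD1 n) //= (introT (dP m n) mn) !big1 ?addr0 //.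
  move=> m' mm'; rewrite big1 // => n' _; case: dP => // mn'.
  by have [m1 _] := subdivision_uniq mn mn'; rewrite m1 eqxx in mm'.
move=> n' nn'; case: dP => // mn'.
by have [_ n1] := subdivision_uniq mn mn'; rewrite n1 eqxx in nn'.
Qed.

(** Compares the coefficients of [co C a p * co C b q] at [(x, y)]: on one side the indicator that
    [p, q] and [x, y] have the same composite, on the other the number of subdivisions. *)
Lemma copM a b : full s -> cop (a * b) = tens_mul (cop a) (cop b).
Proof.
move=> fs; apply: (coP (C := C2)) => -[x y]; rewrite co_tens_mul co_cop /=.
rewrite -sum_some sum_co_mul.
under [RHS]eq_bigr => m _.
  under eq_bigr => n _.
    rewrite !co_cop !co_mul_ba -!sum_some mulr_suml mulr_suml.
    under eq_bigr do rewrite mulr_sumr mulr_suml.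
    over.
  over.
transitivity (\sum_p \sum_q \sum_(m : s * s) \sum_(n : s * s)
  (co C a p * co C b q) *
  (((comp2 m.1 m.2 == Some p)%:R * (comp2 n.1 n.2 == Some q)%:R) *
      ((comp1 m.1 n.1 == Some x)%:R * (comp1 m.2 n.2 == Some y)%:R))); last first.
  rewrite exchange_big2; apply: eq_bigr => m _; apply: eq_bigr => n _.
  apply: eq_bigr => p _; apply: eq_bigr => q _.
  by rewrite mulrA; congr (_ * _); rewrite [RHS]mulrACA mulrC.
rewrite -(pair_bigA _ (fun p q => oapp (fun z => (comp2 x y == Some z)%:R) 0
   (comp1 p q) * (co C a p * co C b q))) /=.
apply: eq_bigr => p _; apply: eq_bigr => q _.
under [RHS]eq_bigr do rewrite -mulr_sumr.
rewrite -mulr_sumr sum_subdivision // mulrC; congr (_ * _).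
by rewrite -sum_some; apply: eq_bigr => z _; rewrite mulrC.
Qed.

Lemma antipode_ba x : antipode (ba C x) = ba C (inv1 (inv2 x)).
Proof.
apply: (coP (C := C)) => y; rewrite co_antipode !co_ba.
by rewrite -{1}[x]inv12K (can_eq inv12K).
Qed.

Lemma bilinear_antipodel : bilinear_map (fun x y : A => antipode x * y).
Proof. exact: bilinear_comp (bilinear_mul A) antipode_linear (@linear_id _ _). Qed.

Lemma bilinear_antipoder : bilinear_map (fun x y : A => x * antipode y).
Proof. exact: bilinear_comp (bilinear_mul A) (@linear_id _ _) antipode_linear. Qed.

(** Common part of both antipode equations, with [c] the composition occurring in each: for every
    [r] in [unit2] and [z] in [unit1] exactly one pair contributes, and no other [r], [z] do. *)
Lemma sum_antipode (c : s -> s -> option s) a z :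
    (forall r, unit1 z -> unit2 r -> exists w, forall x y,
      comp2 x y = Some r /\ c x y = Some z <-> (x, y) = (w, inv2 w)) ->
    (forall r x y, comp2 x y = Some r /\ c x y = Some z -> unit2 r /\ unit1 z) ->
  \sum_(p : s * s) oapp (co C a) 0 (comp2 p.1 p.2) * (c p.1 p.2 == Some z)%:R =
  eps a * (unit1 z)%:R.
Proof.
move=> H1 H2; under eq_bigr do rewrite -sum_some mulr_suml.
rewrite exchange_big epsE mulr_suml; apply: eq_bigr => r _ /=.
under eq_bigr do rewrite mulrAC mulrC.
rewrite -mulr_sumr -mulrA; congr (_ * _); rewrite -natrM mulnb.
have [/andP[r2 z1]|N] := boolP (_ && _).
  have [w wP] := H1 r z1 r2.
  rewrite (bigD1 (w, inv2 w)) //= big1 ?addr0 => [|[x y] /= xy].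
    by have [-> ->] := (wP _ _).2 erefl; rewrite !eqxx mulr1.
  rewrite -natrM mulnb (_ : _ && _ = false) //.
  by apply: contraNF xy => /andP[/eqP e1 /eqP e2]; apply/eqP/wP.
rewrite big1 // => -[x y] _ /=; rewrite -natrM mulnb (_ : _ && _ = false) //.
by apply: contraNF N => /andP[/eqP e1 /eqP e2]; apply/andP/(H2 r x y).
Qed.

Lemma antipode_left a : full s ->
  tens_lift (fun x y => antipode x * y) (cop a) = eps a *: 1.
Proof.
move=> fs; apply: (coP (C := C)) => z.
rewrite (tens_lift_co C C _ bilinear_antipodel) co_sum coZ co_one.
under eq_bigr do rewrite co_cop antipode_ba co_mul_ba.
apply: (sum_antipode (c := fun x y => comp1 (inv1 (inv2 x)) y)) => [r z1 r2|r x y].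
  (* Fullness supplies the square with the corner (v, u) required by [antipode_comp_l]. *)
  have [w [wv wu]] := fs.2 _ _ (skK r) (sq_HV (shH z)).
  exists w => x y; rewrite antipode_comp_l; split=> [[_ _ -> xv xu]|[-> ->]] //.
  suff -> : x = w by [].
  by apply: corner_vu; rewrite ?xv ?xu.
by move/antipode_comp_l => -[].
Qed.

Lemma antipode_right a : full s ->
  tens_lift (fun x y => x * antipode y) (cop a) = eps a *: 1.
Proof.
move=> fs; apply: (coP (C := C)) => z.
rewrite (tens_lift_co C C _ bilinear_antipoder) co_sum coZ co_one.
under eq_bigr do rewrite co_cop antipode_ba co_mul_ba.
apply: (sum_antipode (c := fun x y => comp1 x (inv1 (inv2 y)))) => [r z1 r2|r x y].
  have [w [wh wv]] := corner_ex_hv fs (shH z) (skK r).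
  exists w => x y; rewrite antipode_comp_r; split=> [[_ _ -> xv xh]|[-> ->]] //.
  suff -> : x = w by [].
  by apply: corner_hv; rewrite ?xv ?xh.
by move/antipode_comp_r => -[].
Qed.

Lemma squares_hopf_algebra : full s -> hopf_algebra cop eps antipode.
Proof.
move=> fs; split.
- by split; [exact: cop_linear|exact: cop_coassoc].
- by split; [exact: counit_scalar|apply: cop_counital counit_scalar counit_ba].
- exact: counit_morphism.
- by split; [exact: cop1|move=> a b; apply: copM].
- split; first exact: antipode_linear.
  by move=> a; split; [exact: antipode_left|exact: antipode_right].
Qed.

End Counit.

(** * The involution *)

Section Star.
Variable star : A -> A.
Hypothesis starE : forall a x, co C (star a) x = (co C a (inv1 x))^*.

Lemma co_tens_star t p :
  co C2 (tens_star star t) p = (co C2 t (inv1 p.1, inv1 p.2))^*.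
Proof.
rewrite /tens_star /tens_lift.
have c2_sum (I : finType) (w : I -> tensor A A) :
    co C2 (\sum_i w i) p = \sum_i co C2 (w i) p.
  under eq_bigr do rewrite -[w _]scale1r.
  by rewrite co_sum; apply: eq_bigr => i _; rewrite mul1r -[w i]scale1r coZ mul1r.
(* [tens_star] conjugates coordinates with respect to [vbasis], so the two sides are compared term
   by term in that basis. *)
rewrite c2_sum [in RHS]/co /= rmorph_sum; apply: eq_bigr => i _.
rewrite co_sum rmorph_sum; apply: eq_bigr => j _.
by rewrite co_pure !starE !mxE !rmorphM.
Qed.

Lemma squares_star_coproduct : star_coproduct cop star.
Proof.
split; first split.
- move=> c a b; apply: (coP (C := C)) => x.
  by rewrite coPl !starE coPl rmorphD rmorphM.
- by move=> a; apply: (coP (C := C)) => x; rewrite !starE conjCK inv1K.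
- move=> a b; apply: (coP (C := C)) => z; rewrite starE.
  rewrite (co_mul_anti a b z (@inv1K G s) (@inv1_comp1 G s)) co_mul rmorph_sum.
  by apply: eq_bigr => p _; rewrite !rmorphM rmorph_nat !starE.
move=> a; apply: (coP (C := C2)) => p; rewrite co_tens_star !co_cop /= inv1_comp2.
by case: comp2 => [z|] /=; rewrite ?starE // conjC0.
Qed.

End Star.

End SquareAlgebra.

(** * Duality between the algebras of the two compositions *)

Section DualPair.
Variables (F : numClosedFieldType) (A B : falgType F) (G : groupType).
Variables (s : squares G) (CA : coords A s) (CB : coords B (swap s)).
Hypothesis co_mulA : forall a b z, co CA (a * b) z =
  \sum_(p : s * s) (comp1 p.1 p.2 == Some z)%:R * (co CA a p.1 * co CA b p.2).
Hypothesis co_oneA : forall x, co CA 1 x = (unit1 x)%:R.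
Hypothesis co_mulB : forall a b (z : s), co CB (a * b) z =
  \sum_(p : s * s) (comp2 p.1 p.2 == Some z)%:R * (co CB a p.1 * co CB b p.2).
Hypothesis co_oneB : forall x : s, co CB 1 x = (unit2 x)%:R.
Variables (starA : A -> A) (starB : B -> B).
Hypothesis starAE : forall a x, co CA (starA a) x = (co CA a (inv1 x))^*.
Hypothesis starBE : forall b (x : s), co CB (starB b) x = (co CB b (inv2 x))^*.
Variable p : A -> B -> F.
Hypothesis pE : forall a b, p a b = \sum_x co CA a x * co CB b x.

(** Exchanging the edges twice changes nothing, so the coproduct of [B] is dual to the product of
    [A]. *)
Lemma swap_comp2 (x y : s) : @comp2 _ (swap s) x y = comp1 x y.
Proof. by case: s x y. Qed.

Lemma swap_unit2 (x : s) : @unit2 _ (swap s) x = unit1 x.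
Proof. by case: s x. Qed.

Lemma pairing_bilinear : bilinear_pairing p.
Proof.
split=> [a|b] c x y; rewrite !pE mulr_sumr -big_split; apply: eq_bigr => i _ /=.
  by rewrite coPl mulrDr mulrCA.
by rewrite coPl mulrDl mulrA.
Qed.

Lemma pairing_bal x b : p (ba CA x) b = co CB b x.
Proof. by rewrite pE (sum_co_bar CA (co CB b)). Qed.

Lemma pairing_bar a x : p a (ba CB x) = co CA a x.
Proof.
rewrite pE; under eq_bigr do rewrite mulrC.
exact: (sum_co_bar CB (co CA a) x).
Qed.

Lemma pairing_nondegenerate : Defs.nondegenerate p.
Proof.
split=> [a a0|b b0].
  by apply: (coP (C := CA)) => x; rewrite -pairing_bar a0 co0.
by apply: (coP (C := CB)) => x; rewrite -pairing_bal b0 co0.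
Qed.

Lemma bilinear_pairing_tens a a' :
  bilinear_map (fun b b' => p a b * p a' b' : F^o).
Proof.
have [pr pl] := pairing_bilinear; split=> [b|b'] c x y; rewrite pr.
  by rewrite mulrDr mulrCA.
by rewrite mulrDl -mulrA.
Qed.

Lemma bilinear_pairing_tensr b b' :
  bilinear_map (fun a a' => p a b * p a' b' : F^o).
Proof.
have [pr pl] := pairing_bilinear; split=> [a|a'] c x y; rewrite pl.
  by rewrite mulrDr mulrCA.
by rewrite mulrDl -mulrA.
Qed.

(** The two bases are dual under [p]; the coordinates of [cop CA] are thus its pairings with basis
    tensors, which transpose the product of [B]. *)
Lemma induced_l : induced_coproduct_l p (cop CA).
Proof.
move=> a b b'; rewrite /tens_pairing.
rewrite (eq_tens_lift (b' := fun a a' => p a b * p a' b' : F^o)) => [|x y]; last first.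
  by have [br bl] := bilinear_pairing_tens x y; rewrite tens_lift_pure.
rewrite (tens_lift_co CA CA _ (bilinear_pairing_tensr b b')) pE.
rewrite (sum_co_mul (s := swap s) co_mulB); apply: eq_bigr => q _.
by rewrite co_cop !pairing_bal.
Qed.

Lemma induced_r : induced_coproduct_r p (cop CB).
Proof.
move=> a a' b; rewrite /tens_pairing.
have bl t : bilinear_map (fun a a' : A =>
    tens_lift (fun b b' => p a b * p a' b' : F^o) t).
  have E c c' := (bilinear_pairing_tensr c c').
  split=> x; apply: linear_tens_lift => u v c y z.
    exact: (E u v).1.
  exact: (E u v).2.
rewrite tens_lift_pure; [|exact: (bl _).1|exact: (bl _).2].
rewrite (tens_lift_co CB CB _ (bilinear_pairing_tens a a')) pE.
under [RHS]eq_bigr do rewrite mulrC.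
rewrite (sum_co_mul co_mulA); apply: eq_bigr => q _.
by rewrite co_cop !pairing_bar swap_comp2.
Qed.

(** [starA (antipode CA a)] takes at [x] the conjugate of the value of [a] at [inv2 x], since the
    two [inv1] cancel; reindexing by [inv2] does the rest. *)
Lemma pairing_star a b : p a (starB b) = (p (starA (antipode CA a)) b)^*.
Proof.
rewrite !pE rmorph_sum (reindex_inj (can_inj (@inv2K G s))).
apply: eq_bigr => x _; rewrite rmorphM /= starBE starAE conjCK co_antipode.
by rewrite -inv12C inv1K inv2K.
Qed.

Lemma counitA a : p a 1 = \sum_x co CA a x * (unit2 x)%:R.
Proof. by rewrite pE; apply: eq_bigr => x _; rewrite co_oneB. Qed.

Lemma counitB b : p 1 b = \sum_(x : swap s) co CB b x * (unit2 x)%:R.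
Proof.
by rewrite pE; apply: eq_bigr => x _; rewrite co_oneA swap_unit2 mulrC.
Qed.

Lemma squares_dual_pair_qh :
  dual_pair (@finite_star_quantum_hypergroup F) p starA starB.
Proof.
split; [exact: pairing_bilinear|exact: pairing_nondegenerate|].
exists (cop CA), (cop CB), (antipode CA), (antipode CB).
split; [exact: induced_l|exact: induced_r|split|split|exact: pairing_star].
- exact: (squares_quantum_hypergroup co_mulA co_oneA counitA).
- exact: (squares_star_coproduct co_mulA starAE).
- exact: (squares_quantum_hypergroup (s := swap s) co_mulB co_oneB counitB).
- exact: (squares_star_coproduct (s := swap s) co_mulB starBE).
Qed.

Lemma squares_dual_pair_hopf : full s ->
  dual_pair (@hopf_star_algebra F) p starA starB.
Proof.
move=> fs; have fs' : full (swap s) by have [f1 f2] := fs.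
split; [exact: pairing_bilinear|exact: pairing_nondegenerate|].
exists (cop CA), (cop CB), (antipode CA), (antipode CB).
split; [exact: induced_l|exact: induced_r|split|split|exact: pairing_star].
- exact: (squares_hopf_algebra co_mulA co_oneA counitA fs).
- exact: (squares_star_coproduct co_mulA starAE).
- exact: (squares_hopf_algebra (s := swap s) co_mulB co_oneB counitB fs').
- exact: (squares_star_coproduct (s := swap s) co_mulB starBE).
Qed.

End DualPair.

(** * The squares of Omega *)

Section OmegaSquares.
Variables (G : groupType) (D : subgroup_pair G).
Local Open Scope group_scope.
Implicit Types x y z : Omega D.

Lemma Omega_spec x :
  [/\ (val x).1 \in lsub D, (val x).2 \in rsub D,
      lact D (val x).1 (val x).2 \in rsub D,
      ract D (val x).1 (val x).2 \in lsub D &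
      (val x).1 * (val x).2 =
      lact D (val x).1 (val x).2 * ract D (val x).1 (val x).2].
Proof. by apply/in_Omega; rewrite -surjective_pairing (valP x). Qed.

Lemma Omega_inj x y : (val x).1 = (val y).1 -> (val x).2 = (val y).2 ->
  lact D (val x).1 (val x).2 = lact D (val y).1 (val y).2 ->
  ract D (val x).1 (val x).2 = ract D (val y).1 (val y).2 -> x = y.
Proof.
move=> e1 e2 _ _; apply: val_inj.
by rewrite [LHS]surjective_pairing e1 e2 -surjective_pairing.
Qed.

Lemma Omega_ex h k v u : h \in lsub D -> k \in rsub D -> v \in rsub D ->
  u \in lsub D -> h * k = v * u ->
  exists x, [/\ (val x).1 = h, (val x).2 = k,
    lact D (val x).1 (val x).2 = v & ract D (val x).1 (val x).2 = u].
Proof.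
move=> hH kK vK uH E; have [hk lE rE] := OmegaP hH kK vK uH E.
by exists [` hk]%fset.
Qed.

Definition Omega_squares : squares G :=
  @Squares G (Omega D) [in lsub D] [in rsub D] (lsub_closed D) (rsub_closed D)
    (@lrsub1 G D) (fun x => (val x).1) (fun x => (val x).2)
    (fun x => lact D (val x).1 (val x).2) (fun x => ract D (val x).1 (val x).2)
    Omega_spec Omega_inj Omega_ex.

(** The inclusion of HK in KH provides the corners (h, k), the reverse inclusion the corners (v,
    u). *)
Lemma Omega_full :
  [fset (h * k)%g | h in lsub D, k in rsub D]%fset =
    [fset (k * h)%g | k in rsub D, h in lsub D]%fset ->
  full Omega_squares.
Proof.
move=> HK; split=> [h k hH kK|v u vK uH].
  have : h * k \in [fset (h * k)%g | h in lsub D, k in rsub D]%fset.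
    by apply/imfset2P; exists h => //; exists k.
  rewrite HK => /imfset2P[v /= vK [u /= uH E]].
  by have [x [xh xk _ _]] := Omega_ex hH kK vK uH E; exists x.
have : v * u \in [fset (k * h)%g | k in rsub D, h in lsub D]%fset.
  by apply/imfset2P; exists v => //; exists u.
rewrite -HK => /imfset2P[h /= hH [k /= kK E]].
by have [x [_ _ xv xu]] := Omega_ex hH kK vK uH (esym E); exists x.
Qed.

End OmegaSquares.

(** * The two algebras of functions on Omega in square coordinates *)

Section OmegaAlgebras.
Variables (F : numClosedFieldType) (G : groupType) (D : subgroup_pair G).
Local Notation s := (Omega_squares D).

(** Used to turn sums over a subgroup into sums over Omega; both sides vanish off Omega. *)
Lemma ev_sum (f : {ffun Omega D -> F^o}) h k :
  ev f h k = \sum_x (val x == (h, k))%:R * f x.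
Proof.
rewrite /ev -sum_some; apply: eq_bigr => x _; congr (_%:R * _).
case: insubP => [y _ <-|hk]; first by rewrite (inj_eq (@Some_inj _)) eq_sym.
by case: (val x =P _) => // xhk; rewrite -xhk (valP x) in hk.
Qed.

Lemma ev0 (f : {ffun Omega D -> F^o}) h k : (h, k) \notin Omega D -> ev f h k = 0.
Proof. by move=> hk; rewrite /ev insubF // (negbTE hk). Qed.

Lemma ffun_expand (f : {ffun Omega D -> F^o}) :
  f = \sum_x f x *: [ffun y => (x == y)%:R].
Proof.
apply/ffunP => y; rewrite sum_ffunE (bigD1 y) //= !ffunE eqxx [_ *: _]mulr1.
rewrite big1 ?addr0 // => x /negPf xy; rewrite !ffunE xy; exact: mulr0.
Qed.

(** The basis of point masses, kept transparent so that [Omega_pairingE] holds by computation. *)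
Definition C_Omega_coords : coords (C_Omega F D) s.
Proof.
refine (@Coords _ _ s (fun (f : C_Omega F D) x => f x)
  (fun x => [ffun y => (x == y)%:R]) _ (@ffun_expand) _).
  by move=> x c f g; rewrite !ffunE.
by move=> x y; rewrite ffunE.
Defined.

Definition C_Omega_hat_coords : coords (C_Omega_hat F D) (swap s).
Proof.
refine (@Coords _ _ (swap s) (fun (f : C_Omega_hat F D) x => f x)
  (fun x => [ffun y => (x == y)%:R]) _ (@ffun_expand) _).
  by move=> x c f g; rewrite !ffunE.
by move=> x y; rewrite ffunE.
Defined.

Local Notation CA := C_Omega_coords.
Local Notation CB := C_Omega_hat_coords.

Lemma co_C_OmegaE f x : co CA f x = ev f (sh (s := s) x) (sk (s := s) x).
Proof. by rewrite [RHS]ev_val. Qed.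

Lemma co_C_Omega_hatE f (x : s) : co CB f x = ev f (sh (s := s) x) (sk (s := s) x).
Proof. by rewrite [RHS]ev_val. Qed.

Lemma Omega_mem (x : s) : (sh x, sk x) \in Omega D.
Proof. by rewrite -surjective_pairing; apply: valP. Qed.

Lemma eq_pairs (x : s) h k : (val x == (h, k)) = (sh x == h) && (sk x == k).
Proof. by rewrite [val x]surjective_pairing. Qed.

Lemma C_Omega_co_mul a b z : co CA (a * b) z =
  \sum_(p : s * s) (comp1 p.1 p.2 == Some z)%:R * (co CA a p.1 * co CA b p.2).
Proof.
rewrite co_C_OmegaE C_OmegaE ?Omega_mem //.
transitivity (\sum_(v <- rsub D) ev a (sh z) v *
    ev b (ract D (sh z) v) (v^-1 * sk z)%g).
  rewrite big_mkcond; apply: eq_bigr => v _; case: ifPn => // /ev0 ->.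
  by rewrite mul0r.
under eq_bigr do rewrite ev_sum mulr_suml.
rewrite exchange_big -(pair_bigA _ (fun x y => (comp1 x y == Some z)%:R *
  (co CA a x * co CA b y))) /=; apply: eq_bigr => x _.
(* For a fixed first square [x] only [v = sk x] contributes; the remaining conditions are those of
   [comp1_hk]. *)
rewrite (bigD1_seq (sk (s := s) x)) ?fset_uniq //=; last exact: (skK (s := s)).
rewrite big1 ?addr0 => [|v xv]; last first.
  by rewrite (eq_pairs x) [sk (s := s) x == v]eq_sym (negPf xv) andbF !mul0r.
rewrite ev_sum mulr_sumr; apply: eq_bigr => y _.
rewrite (eq_pairs x) eqxx andbT mulrACA -natrM mulnb; congr (_%:R * _).
rewrite (eq_pairs y); congr nat_of_bool.
apply/idP/idP => [/and3P[/eqP e1 /eqP e2 /eqP e3]|].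
  by apply/eqP/(@comp1_hk G s x y z); split=> //; rewrite e2 -e1.
move/eqP/(@comp1_hk G s x y z) => [e1 e2 e3]; apply/and3P.
by split; apply/eqP => //; rewrite -[(fsval z).1]e1.
Qed.

Lemma C_Omega_hat_co_mul a b (z : s) : co CB (a * b) z =
  \sum_(p : s * s) (comp2 p.1 p.2 == Some z)%:R * (co CB a p.1 * co CB b p.2).
Proof.
rewrite co_C_Omega_hatE C_Omega_hatE ?Omega_mem //.
transitivity (\sum_(u <- lsub D) ev a (sh z * u^-1)%g (lact D u (sk z)) *
    ev b u (sk z)).
  rewrite big_mkcond; apply: eq_bigr => u _; case: ifPn => // /ev0 ->.
  by rewrite mulr0.
under eq_bigr do rewrite [ev b _ _]ev_sum mulr_sumr.
rewrite exchange_big -(pair_bigA _ (fun x y => (comp2 x y == Some z)%:R *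
  (co CB a x * co CB b y))) [RHS]exchange_big /=; apply: eq_bigr => y _.
(* Here the second square is fixed first, and it determines [u = sh y]. *)
rewrite (bigD1_seq (sh (s := s) y)) ?fset_uniq //=; last exact: (shH (s := s)).
rewrite big1 ?addr0 => [|u xu]; last first.
  by rewrite (eq_pairs y) [sh (s := s) y == u]eq_sym (negPf xu) mul0r mulr0.
rewrite ev_sum mulr_suml; apply: eq_bigr => x _.
rewrite (eq_pairs y) eqxx mulrACA -natrM mulnb; congr (_%:R * _).
rewrite (eq_pairs x); congr nat_of_bool.
apply/idP/idP => [/andP[/andP[/eqP e1 /eqP e2] /eqP e3]|].
  by apply/eqP/(@comp2_hk G s x y z); split=> //; rewrite e2 -e3.
move/eqP/(@comp2_hk G s x y z) => [e1 e2 e3].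
apply/andP; split; last exact/eqP.
by apply/andP; split; apply/eqP => //; rewrite -[(fsval z).2]e1.
Qed.

Lemma C_Omega_co_one x : co CA 1 x = (unit1 x)%:R.
Proof. by rewrite co_C_OmegaE C_Omega1E ?Omega_mem. Qed.

Lemma C_Omega_hat_co_one (x : s) : co CB 1 x = (unit2 x)%:R.
Proof. by rewrite co_C_Omega_hatE C_Omega_hat1E ?Omega_mem // unit2_sh. Qed.

Lemma C_Omega_co_star a x : co CA (Omega_star a) x = (co CA a (inv1 x))^*.
Proof.
rewrite !co_C_OmegaE sh_inv1 sk_inv1.
by rewrite [LHS]ev_of_fun // Omega_mem.
Qed.

Lemma C_Omega_hat_co_star b (x : s) :
  co CB (Omega_hat_star b) x = (co CB b (inv2 x))^*.
Proof.
rewrite !co_C_Omega_hatE sh_inv2 sk_inv2.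
by rewrite [LHS]ev_of_fun // Omega_mem.
Qed.

Lemma Omega_pairingE a b : Omega_pairing a b = \sum_x co CA a x * co CB b x.
Proof. by []. Qed.

End OmegaAlgebras.

Theorem theorem6p4 (R : realType) (G : groupType) (H K : {fset G})
    (hH : group_closed [in H]) (hK : group_closed [in K])
    (hHK : (H `&` K)%fset = [fset 1%g]%fset) :
  let D := SubgroupPair hH hK hHK in
  dual_pair (@finite_star_quantum_hypergroup R[i])
    (@Omega_pairing R[i] G D) (@Omega_star R[i] G D) (@Omega_hat_star R[i] G D)
  /\
  ([fset (h * k)%g | h in H, k in K]%fset
     = [fset (k * h)%g | k in K, h in H]%fset ->
   dual_pair (@hopf_star_algebra R[i])
     (@Omega_pairing R[i] G D) (@Omega_star R[i] G D)
     (@Omega_hat_star R[i] G D)).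
Proof.
move=> D; split=> [|HK].
  exact: (squares_dual_pair_qh (@C_Omega_co_mul R[i] G D) (@C_Omega_co_one R[i] G D)
    (@C_Omega_hat_co_mul R[i] G D) (@C_Omega_hat_co_one R[i] G D)
    (@C_Omega_co_star R[i] G D) (@C_Omega_hat_co_star R[i] G D)
    (@Omega_pairingE R[i] G D)).
exact: (squares_dual_pair_hopf (@C_Omega_co_mul R[i] G D) (@C_Omega_co_one R[i] G D)
    (@C_Omega_hat_co_mul R[i] G D) (@C_Omega_hat_co_one R[i] G D)
    (@C_Omega_co_star R[i] G D) (@C_Omega_hat_co_star R[i] G D)
    (@Omega_pairingE R[i] G D) (@Omega_full G D HK)).
Qed.
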